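(* For any positive integer $d$ and any non-negative integer $n$, we have $$Z^\star_0(d,n)=4\pi^{2n+4d}\sum_{k=0}^{n+2d}\sum_{r=0}^n(-1)^{n+k+r}(4^{k+1}-1)\binom{k}{r}\binom{n+2d-k}{n-r}\frac{B_{2k+2}}{(2k+2)!}\frac{B_{2n+4d-2k}}{(2n+4d-2k)!},$$ $$Z^\star(d,n)=4\pi^{2n+4d}\sum_{k=0}^{n+2d}\sum_{r=0}^n (-1)^{n+k+r}(4^{k+1}-1)\binom{k+1}{r}\binom{n+2d-k}{n-r}\frac{B_{2k+2}}{(2k+2)!}\frac{B_{2n+4d-2k}}{(2n+4d-2k)!},$$ and, for $n\ge 1$, $$Z^\star_1(d,n)=4\pi^{2n+4d}\sum_{k=0}^{n+2d}\sum_{r=0}^{n-1}(-1)^{n+k+r+1}(4^{k+1}-1)\binom{k}{r}\binom{n+2d-k}{n-1-r}\frac{B_{2k+2}}{(2k+2)!}\frac{B_{2n+4d-2k}}{(2n+4d-2k)!}.$$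
   Context: For positive integers $s_1,\ldots,s_r$ with $s_1>1$, the multiple zeta star value is $\zeta^\star(s_1,\ldots,s_r)=\sum_{k_1\ge\cdots\ge k_r\ge 1}\frac{1}{k_1^{s_1}\cdots k_r^{s_r}}$ (sum over positive integers). $\{2\}^a$ denotes the number $2$ repeated $a$ times (nothing if $a=0$). Define $$Z^\star(d,n)=\sum_{a_1+\cdots+a_{2d+1}=n}\zeta^\star(\{2\}^{a_1},3,\{2\}^{a_2},1,\ldots,3,\{2\}^{a_{2d}},1,\{2\}^{a_{2d+1}}),$$ $$Z^\star_0(d,n)=\sum_{a_1+\cdots+a_{2d}=n}\zeta^\star(\{2\}^{a_1},3,\{2\}^{a_2},1,\ldots,3,\{2\}^{a_{2d}},1),$$ $$Z^\star_1(d,n)=\sum_{a_1+\cdots+a_{2d+1}=n-1}\zeta^\star(\{2\}^{a_1},3,\{2\}^{a_2},1,\ldots,3,\{2\}^{a_{2d}},1,\{2\}^{a_{2d+1}+1}),$$ where all sums run over tuples of non-negative integers $a_i$. In each index the strings are $\{2\}^{a_{2i-1}},3,\{2\}^{a_{2i}},1$ for $i=1,\ldots,d$ in order, followed by the final block of twos if present. The Bernoulli numbers $B_s$ are defined by $\frac{t}{e^t-1}=\sum_{s=0}^\infty B_s\frac{t^s}{s!}$. Binomial coefficients $\binom{a}{b}$ with non-negative integers $a<b$ are $0$. *)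

(* Defs.v *)
From HB Require Import structures.
From mathcomp Require Import all_boot all_order all_algebra.
From mathcomp Require Import all_classical all_reals all_analysis.
From mathcomp Require Import lra.
Set Implicit Arguments.
Unset Strict Implicit.
Unset Printing Implicit Defensive.
Import Order.TTheory GRing.Theory Num.Theory.
Import numFieldNormedType.Exports.
Local Open Scope classical_set_scope.
Local Open Scope ring_scope.

(* An index (s_1, ..., s_r) is a sequence of naturals, and the summation
   variables (k_1, ..., k_r) are a sequence of the same size.  The value lies in
   \bar R: it is the unconditional sum of a family of nonnegative terms, and it
   is +oo exactly when that family is not summable, so that an equation between
   it and a real number includes convergence.  The terms carry their usual
   meaning for every index; convergence requires s_1 > 1. *)
Definition zeta_star (R : realType) (s : seq nat) : \bar R :=
  \esum_(k in [set k : seq nat |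
                 [/\ size k = size s, sorted geq k & all (leq 1) k]])
    (\prod_(i < size s) ((nth 0%N k i)%:R ^- nth 0%N s i))%:E.

(* [:: a_1; a_2; ...] is sent to the concatenation
   {2}^a_1, 3, {2}^a_2, 1, {2}^a_3, 3, {2}^a_4, 1, ...;
   an unpaired last entry contributes only its block of twos. *)
Fixpoint index31 (a : seq nat) : seq nat :=
  match a with
  | a1 :: a2 :: a' =>
      nseq a1 2%N ++ 3%N :: nseq a2 2%N ++ 1%N :: index31 a'
  | [:: a1] => nseq a1 2%N
  | [::] => [::]
  end.

(* The entries of a tuple of naturals with sum at most n are at most n, hence
   the type 'I_n.+1 for the summation variables below. *)
Definition Zstar (R : realType) (d n : nat) : \bar R :=
  (\sum_(a : d.*2.+1.-tuple 'I_n.+1 | (\sum_(i < d.*2.+1) tnth a i == n)%N)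
     zeta_star R (index31 [seq val x | x <- a]))%E.

Definition Zstar0 (R : realType) (d n : nat) : \bar R :=
  (\sum_(a : d.*2.-tuple 'I_n.+1 | (\sum_(i < d.*2) tnth a i == n)%N)
     zeta_star R (index31 [seq val x | x <- a]))%E.

(* The condition sum = n - 1 is written sum + 1 = n, which avoids truncated
   subtraction; entry number d.*2 (counting from 0) is a_(2d+1). *)
Definition Zstar1 (R : realType) (d n : nat) : \bar R :=
  (\sum_(a : d.*2.+1.-tuple 'I_n.+1 |
         ((\sum_(i < d.*2.+1) tnth a i).+1 == n)%N)
     zeta_star R (index31 (incr_nth [seq val x | x <- a] d.*2)))%E.

(* The generating function has a removable singularity at t = 0, hence the
   punctured neighbourhood. *)
Definition bernoulli_gen (R : realType) (B : nat -> R) : Prop :=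
  \forall t \near (0 : R)^',
    pseries (fun s => B s / s`!%:R) t @ \oo --> t / (expR t - 1).

(* Such a sequence exists (bernoulli_exists below) and is unique, since the
   coefficients of a power series are determined by its sum. *)
Definition bernoulli (R : realType) : nat -> R := get [set B | bernoulli_gen B].

Section bernoulli_existence.
Variable R : realType.

Let c (j : nat) : R := (j.+1`!%:R)^-1.

Fixpoint bern_seq (n : nat) : seq R :=
  if n is m.+1 then
    let s := bern_seq m in rcons s (- \sum_(j < m.+1) s`_j * c (m.+1 - j))
  else [:: 1].

Let b n := (bern_seq n)`_n.

Lemma size_bern_seq n : size (bern_seq n) = n.+1.
Proof. by elim: n => //= n IH; rewrite size_rcons IH. Qed.

Lemma nth_bern_seq n j : (j <= n)%N -> (bern_seq n)`_j = b j.
Proof.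
elim: n => [|n IH]; first by rewrite leqn0 => /eqP ->.
rewrite leq_eqVlt => /predU1P[-> //|]; rewrite ltnS => jn.
by rewrite /= nth_rcons size_bern_seq ltnS jn IH.
Qed.

Lemma bern_conv n : \sum_(j < n.+1) b j * c (n - j) = (n == 0%N)%:R.
Proof.
case: n => [|n].
  by rewrite big_ord1 /b /c /= invr1 mulr1.
rewrite big_ord_recr /= {2}/b /= nth_rcons size_bern_seq ltnn eqxx subnn.
rewrite [c 0]invr1 mulr1.
under eq_bigr => j _ do rewrite -(@nth_bern_seq n) ?leq_ord//.
by rewrite subrr.
Qed.

Lemma c_ge0 j : 0 <= c j. Proof. by rewrite invr_ge0. Qed.

Lemma c_le1 j : c j <= 1.
Proof. by rewrite invf_le1 ?ltr0n ?fact_gt0// ler1n fact_gt0. Qed.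

Lemma norm_b n : `|b n| <= 2 ^+ n.
Proof.
have [m] := ubnP n; elim: m n => // m IH [|n] nm.
  by rewrite /b /= normr1 expr0.
have := bern_conv n.+1; rewrite big_ord_recr /= subnn [c 0]invr1 mulr1.
move=> /eqP; rewrite addrC addr_eq0 => /eqP ->; rewrite normrN.
apply: (@le_trans _ _ (\sum_(j < n.+1) 2 ^+ j)).
  apply: (le_trans (ler_norm_sum _ _ _)); apply: ler_sum => j _.
  rewrite normrM (ger0_norm (c_ge0 _)) -[leRHS]mulr1.
  apply: ler_pM; rewrite ?c_ge0 ?c_le1//.
  by apply: IH; rewrite (leq_trans (ltn_ord j)).
have := subrX1 (2 : R) n.+1; rewrite (_ : 2 - 1 = 1 :> R); last by lra.
by rewrite mul1r => <-; lra.
Qed.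

Lemma norm_conv_le m (N : nat) :
  `|(\poly_(i < N) b i * \poly_(i < N) c i)`_m| <= m.+1%:R * 2 ^+ m.
Proof.
rewrite coefM (le_trans (ler_norm_sum _ _ _))//.
apply: (@le_trans _ _ (\sum_(j < m.+1) (2 : R) ^+ m)); last first.
  by rewrite sumr_const card_ord mulr_natl.
apply: ler_sum => j _; rewrite normrM -[leRHS]mulr1.
apply: ler_pM => //; rewrite coef_poly.
  case: ifP => _; last by rewrite normr0 exprn_ge0.
  by rewrite (le_trans (norm_b _))// ler_weXn2l ?ler1n// leq_ord.
case: ifP => _; last by rewrite normr0.
by rewrite ger0_norm ?c_ge0 ?c_le1.
Qed.

Lemma low_conv m (N : nat) : (m < N)%N ->
  (\poly_(i < N) b i * \poly_(i < N) c i)`_m = (m == 0%N)%:R.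
Proof.
move=> mN; rewrite coefM -bern_conv; apply: eq_bigr => j _.
rewrite !coef_poly (leq_ltn_trans (leq_ord j) mN).
by rewrite (leq_ltn_trans (leq_subr _ _) mN).
Qed.

Lemma conv_bound (N : nat) (t : R) : (0 < N)%N -> `|t| < 8^-1 ->
  `|series (fun i => b i * t ^+ i) N * series (fun i => c i * t ^+ i) N - 1|
    <= 4 * (8 * `|t|) ^+ N.
Proof.
move=> N0 t8.
have serE (u : nat -> R) :
    series (fun i => u i * t ^+ i) N = (\poly_(i < N) u i).[t].
  by rewrite /series /= horner_poly big_mkord.
rewrite !serE -hornerM.
set P := _ * _.
have sP : (size P <= N + N)%N.
  rewrite (leq_trans (size_polyMleq _ _))// (leq_trans (leq_pred _))//.
  by rewrite leq_add// size_poly.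
rewrite (horner_coef_wide _ sP) big_split_ord /=.
have -> : \sum_(i < N) P`_(i) * t ^+ i = 1.
  case: N N0 @P {sP serE} => // N _ P.
  rewrite big_ord_recl /= low_conv// eqxx expr0 mulr1 big1 ?addr0// => i _.
  by rewrite low_conv ?mul0r// ltnS.
rewrite [1 + _]addrC addrK (le_trans (ler_norm_sum _ _ _))//.
apply: (@le_trans _ _ (\sum_(i < N) (N + N)%:R * (2 * `|t|) ^+ N)).
  apply: ler_sum => i _; rewrite normrM normrX.
  apply: (@le_trans _ _ ((N + i).+1%:R * 2 ^+ (N + i) * `|t| ^+ (N + i))).
    by rewrite ler_wpM2r ?exprn_ge0// norm_conv_le.
  rewrite -mulrA -exprMn; apply: ler_pM; rewrite ?exprn_ge0//.
    by rewrite ler_nat -addnS leq_add2l.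
  have t2 : 0 <= 2 * `|t| <= 1 by move: t8; have := normr_ge0 t; lra.
  by case/andP: t2 => t2 t21; rewrite ler_wiXn2l// leq_addr.
rewrite sumr_const card_ord -[leLHS]mulr_natl mulrA.
apply: (@le_trans _ _ ((4 * (4 : R) ^+ N) * (2 * `|t|) ^+ N)); last first.
  rewrite -mulrA -exprMn; apply: ler_wpM2l => //.
  by rewrite mulrA -natrM.
apply: ler_wpM2r; first by rewrite exprn_ge0// mulr_ge0.
rewrite -natrX -!natrM ler_nat (_ : 4 = 2 * 2)%N// expnMn.
have h : (N <= 2 ^ N)%N by exact/ltnW/ltn_expl.
rewrite addnn -muln2 mulnA mulnC mulnA -mulnA.
apply: leq_mul => //; exact: leq_mul.
Qed.

Lemma bernoulli_exists : exists B : nat -> R, bernoulli_gen B.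
Proof.
exists (fun s => b s * s`!%:R).
rewrite /bernoulli_gen; near=> t.
have t0 : t != 0 by near: t; exact: nbhs_dnbhs_neq.
have t8 : `|t| < 8^-1.
  near: t; apply: dnbhs0_lt; lra.
have e0 : expR t - 1 != 0.
  by rewrite subr_eq0 -expR0; apply: contra_neq t0 => /expR_inj.
have cvg_g : series (fun i => c i * t ^+ i) @ \oo --> (expR t - 1) / t.
  have cE : series (exp_coeff t) @ \oo --> expR t.
    exact: is_cvg_series_exp_coeff.
  have -> : series (fun i => c i * t ^+ i)
      = (fun n => (series (exp_coeff t) n.+1 - 1) / t).
    apply/funext => n; rewrite /series /= big_nat_recl//= {1}/exp_coeff /=.
    rewrite expr0 fact0 divr1 [1 + _]addrC addrK big_distrl /=.
    apply: eq_bigr => i _; rewrite /exp_coeff /= exprSr /c.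
    by rewrite -!mulrA [t * _]mulrCA divff// mulr1 mulrC.
  apply: cvgM; last exact: cvg_cst.
  apply: cvgB; last exact: cvg_cst.
  by move: cE; rewrite -cvg_shiftS.
have cvg_fg : series (fun i => b i * t ^+ i) \* series (fun i => c i * t ^+ i)
    @ \oo --> (1 : R).
  apply/subr_cvg0/norm_cvg0P.
  have h8 : `|8 * `|t| | < 1 by rewrite ger0_norm; have := normr_ge0 t; lra.
  have c8 := @cvg_geometric R 4 _ h8.
  apply: (squeeze_cvgr _ (cvg_cst 0) c8); near=> n.
  rewrite normr_ge0 /= conv_bound//; near: n; exact: nbhs_infty_gt.
have L0 : (expR t - 1) / t != 0 by rewrite mulf_neq0// invr_neq0.
rewrite -[t / _]invf_div -[_^-1]mul1r.
have H := cvgM cvg_fg (cvgV L0 cvg_g).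
apply: (cvg_trans _ (H _ _)); apply: near_eq_cvg; near=> n.
rewrite /= mulfK; last by near: n; exact: (cvgr_neq0 _ cvg_g L0).
by apply: eq_bigr => i _ /=; rewrite mulfK// pnatr_eq0 -lt0n fact_gt0.
Unshelve. all: by end_near. Qed.

End bernoulli_existence.

Lemma bernoulliP (R : realType) : bernoulli_gen (bernoulli R).
Proof. exact: getPex (bernoulli_exists R). Qed.

(* Main.v *)
Require Import Defs.
From HB Require Import structures.
From mathcomp Require Import all_boot all_order all_algebra.
From mathcomp Require Import all_classical all_reals all_analysis.
From mathcomp Require Import ring lra zify.
Set Implicit Arguments.
Unset Strict Implicit.
Unset Printing Implicit Defensive.
Import Order.TTheory GRing.Theory Num.Theory.
Import numFieldNormedType.Exports.
Local Open Scope classical_set_scope.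
Local Open Scope ring_scope.

(** Weight an index {2}^a_1, 3, {2}^a_2, 1, ... by x for every 2 and by y^2 for
every pair 3, 1, and truncate all sums at k_1 <= K.  Let T(K) be the generating
function in which y^(2d) x^n carries Zstar0 d n and y^(2d+1) x^n carries
Zstar1 d (n+1), and let F(K) be its companion for indices that start inside a
pair, between the 3 and the 1.  Splitting off the terms with k_1 = K gives
  T(K) (1 - x/K^2) - T(K-1) = (y - x)/K^2 + (y^2/K^3) F(K),
  F(K) (1 - x/K^2) - F(K-1) = T(K)/K.
It is the odd powers of y, with their extra block of twos, that allow this
system to be solved in closed form.

The solution uses the kernel c(K,k) = K!^2 / ((K-k)! (K+k)!).  It is an
eigenvector of the star summation with exponent 2: the sum of c(m,k)/m^2 over
m <= K is c(K,k)/k^2.  Dividing c(K,k) by K, or multiplying it by K, gives a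
triangular combination of the kernels c(K,j) with j >= k.  In this basis the
system becomes one scalar recurrence
  (k^2 - x) (s_k - s_(k-1)) = -(-1)^k y (s_k + s_(k-1)),
whose solution is a product, and T(K) is the average of the s_k with weights
c(K,k) - c(K,k+1) (cmean_rec, cmean_dual_rec).  As K grows, c(K,k) tends to 1,
so T(K) has the same limit as s_k (cvg_cmean).  In s_k the even and the odd
factors of Euler's product for the sine separate, so the limit is
A cot A / (B cot B) with A = pi sqrt(x-y)/2 and B = pi sqrt(x+y)/2
(cvg_homog_xcot).

The power series of t cot t and tan t / t have Bernoulli coefficients
(has_pseries_cot, has_pseries_tan).  With y = s and x = xi s, comparing the
coefficients of s^m gives an identity between two polynomials in xi, valid on
an interval and hence coefficientwise; this evaluates Zstar0 and Zstar1 at once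
(star_limE).  An index counted by Zstar ends with an empty or a nonempty
block of twos, so Zstar = Zstar0 + Zstar1, which becomes Pascal's rule on the
right-hand side. *)

(** * Truncated star sums *)

Section StarSums.
Variable R : realType.
Implicit Types (s c : seq nat) (K n m : nat).

(** zeta_star with the outer variable bounded by K, organized so that the
outermost summation is peeled off first. *)
Fixpoint starsum s K : R :=
  if s is v :: s' then
    \sum_(1 <= k < K.+1) k%:R ^- v * starsum s' k
  else 1.

Lemma starsum_ge0 s K : 0 <= starsum s K.
Proof.
elim: s K => //= v s IH K; apply: sumr_ge0 => k _.
by rewrite mulr_ge0 // invr_ge0 exprn_ge0.
Qed.

Lemma starsum0 v s : starsum (v :: s) 0 = 0.
Proof. by rewrite /= big_geq. Qed.

Lemma starsumS v s K :
  starsum (v :: s) K.+1 =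
  starsum (v :: s) K + K.+1%:R ^- v * starsum s K.+1.
Proof. by rewrite /= big_nat_recr. Qed.

Lemma starsum_le s : {homo starsum s : K L / (K <= L)%N >-> K <= L}.
Proof.
move=> K L KL; case: s => //= v s.
rewrite [leRHS](@big_cat_nat _ _ _ K.+1) //= lerDl.
apply: sumr_ge0 => k _; by rewrite mulr_ge0 ?starsum_ge0.
Qed.

(** The summation tuples of a truncated star sum: K >= k_1 >= ... >= k_r >= 1. *)
Fixpoint chains r K : seq (seq nat) :=
  if r is r'.+1 then [seq k :: l | k <- iota 1 K, l <- chains r' k]
  else [:: [::]].

Lemma mem_chains r K l : (l \in chains r K) =
  [&& size l == r, sorted geq l, all (leq 1) l & all (geq K) l].
Proof.
elim: r K l => [|r IH] K [|k l] //=.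
  by apply/negP => /allpairsPdep[x [y [_ _]]].
apply/allpairsPdep/idP => [[x [y [xK yx [-> ->]]]]|].
  rewrite eqSS; move: xK yx; rewrite mem_iota IH => /andP[x1 xK] /and4P[-> /= sy y1 yx].
  have {}xK : (x <= K)%N by rewrite add1n ltnS in xK.
  rewrite x1 y1 xK /=.
  rewrite path_sortedE; last by move=> a b e /= ab ea; exact: leq_trans ea ab.
  rewrite yx sy /=; apply/allP => z /(allP yx) /= zx.
  exact: leq_trans zx xK.
rewrite path_sortedE; last by move=> a b e /= ab ea; exact: leq_trans ea ab.
rewrite eqSS => /and4P[sl /andP[lk sl'] /andP[k1 l1] /andP[kK lK]].
exists k, l; split => //; first by rewrite mem_iota k1 add1n ltnS.
by rewrite IH sl sl' l1.
Qed.

Lemma uniq_chains r K : uniq (chains r K).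
Proof.
elim: r K => //= r IH K; apply: allpairs_uniq_dep => //; first exact: iota_uniq.
by move=> [a b] [a' b'] _ _ /= [-> ->].
Qed.

Lemma starsum_chains s K :
  starsum s K = \sum_(l <- chains (size s) K)
    \prod_(i < size s) ((nth 0%N l i)%:R ^- nth 0%N s i).
Proof.
elim: s K => [|v s IH] K /=; first by rewrite big_seq1 big_ord0.
rewrite big_allpairs_dep /= /index_iota subSS subn0.
apply: eq_bigr => k _; rewrite IH mulr_sumr; apply: eq_bigr => l _.
by rewrite big_ord_recl.
Qed.

(** A finite set of admissible tuples lies below some bound K, and the truncated
sums are themselves sums over finite sets, so both sides are the same supremum.
This also covers divergent sums. *)
Lemma zeta_star_cvg s : (fun K => (starsum s K)%:E) @ \oo --> zeta_star R s.
Proof.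
pose f (k : seq nat) : \bar R :=
  (\prod_(i < size s) ((nth 0%N k i)%:R ^- nth 0%N s i))%:E.
have f0 k : (0 <= f k)%E.
  by rewrite lee_fin; apply: prodr_ge0 => i _; rewrite invr_ge0 exprn_ge0.
have chE K : (starsum s K)%:E = \esum_(k in [set` chains (size s) K]) f k.
  rewrite esum_fset //; last exact: finite_seq.
  rewrite -fsbig_seq ?uniq_chains // starsum_chains.
  by rewrite -sumEFin.
have -> : zeta_star R s = ereal_sup (range (fun K => (starsum s K)%:E)).
  apply/eqP; rewrite eq_le; apply/andP; split.
    rewrite /zeta_star -/f; apply: ub_ereal_sup => _ [X [finX XA] <-].
    pose K := (\max_(l <- finmap.enum_fset (fset_set X)) \max_(i <- l) i)%N.
    apply: (@le_trans _ _ (starsum s K)%:E); last first.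
      by apply: ereal_sup_ubound; exists K.
    rewrite chE; apply: esum_ge; exists X => //; split => // l Xl.
    have [sl dl pl] := XA _ Xl.
    rewrite /= mem_chains sl eqxx dl pl /=; apply/allP => i il /=.
    apply: (leq_trans (@leq_bigmax_seq _ l xpredT id i il isT)) => //=.
    rewrite /K.
    apply: (@leq_bigmax_seq _ _ xpredT (fun l : seq nat => \max_(i <- l) i)%N l) => //.
    by rewrite in_fset_set // inE.
  apply: ub_ereal_sup => _ [K _ <-]; rewrite chE.
  rewrite esum_fset //; last exact: finite_seq.
  apply: ereal_sup_ubound; exists [set` chains (size s) K] => //.
  split; first exact: finite_seq.
  by move=> l /=; rewrite mem_chains => /and4P[/eqP].
apply: ereal_nondecreasing_cvgn => K L KL.
by rewrite lee_fin starsum_le.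
Qed.
End StarSums.

(** * Lists of indices *)

Section Families.
Variable R : realType.
Implicit Types (H : nat -> seq (seq nat)) (F : seq nat -> \bar R).

(** The concatenation {2}^a, v, c, where the remaining n - a twos are inside c;
H n lists the possible tails that contain n twos. *)
Definition twos_cons (v : nat) H n : seq (seq nat) :=
  [seq nseq a 2%N ++ v :: c | a <- iota 0 n.+1, c <- H (n - a)%N].

(** For j = 2d these are the indices of Zstar0 d n.  For j = 2d+1 the d pairs are
followed by a nonempty block of twos, which gives the indices of
Zstar1 d (n+1): there one 2 of the last block is not counted in n.  The two
parities obey the same recursion in j and differ in the starting value only. *)
Fixpoint half31 (j n : nat) {struct j} : seq (seq nat) :=
  match j with
  | 0 => if n is 0 then [:: [::]] else [::]
  | 1 => [:: nseq n.+1 2%N]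
  | j'.+2 => twos_cons 3 (twos_cons 1 (half31 j')) n
  end.

Fixpoint full31 (d n : nat) : seq (seq nat) :=
  if d is d'.+1 then twos_cons 3 (twos_cons 1 (full31 d')) n else [:: nseq n 2%N].

Fixpoint compositions (m n : nat) : seq (seq nat) :=
  if m is m'.+1 then [seq a :: c | a <- iota 0 n.+1, c <- compositions m' (n - a)%N]
  else if n is 0 then [:: [::]] else [::].

Lemma big_twos_cons (V : nmodType) v H n (F : seq nat -> V) :
  \sum_(c <- twos_cons v H n) F c =
  \sum_(0 <= a < n.+1) \sum_(c <- H (n - a)%N) F (nseq a 2%N ++ v :: c).
Proof. by rewrite big_allpairs_dep /index_iota subn0. Qed.

Lemma compositionsS m n :
  compositions m.+1 n = [seq a :: c | a <- iota 0 n.+1, c <- compositions m (n - a)%N].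
Proof. by []. Qed.

Lemma mem_compositions m n c : (c \in compositions m n) = (size c == m) && (sumn c == n).
Proof.
elim: m n c => [|m IH] n c; first by case: n; case: c.
rewrite compositionsS; case: c => [|a c].
  by apply/negP => /allpairsPdep[? [? [_ _]]].
apply/allpairsPdep/idP => [[x [y [xn yx [-> ->]]]]|].
  move: xn yx; rewrite mem_iota IH /= add0n ltnS eqSS => xn /andP[-> /eqP ->] /=.
  by rewrite subnKC.
rewrite [size _]/= eqSS => /andP[sc /eqP <-]; exists a, c; split => //.
  by rewrite mem_iota /= ltnS leq_addr.
by rewrite IH sc addKn /=.
Qed.

Lemma uniq_compositions m n : uniq (compositions m n).
Proof.
elim: m n => [[]//|m IH] n; apply: allpairs_uniq_dep => //.
  exact: iota_uniq.
by move=> [a b] [a' b'] _ _ /= [-> ->].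
Qed.

(** Entries with sum n <= N fit in 'I_N.+1, so both sides run over the same
lists. *)
Lemma big_tuple_compositions m N n F : (n <= N)%N ->
  (\sum_(a : m.-tuple 'I_N.+1 | (\sum_(i < m) tnth a i == n)%N)
    F [seq val x | x <- a] = \sum_(c <- compositions m n) F c)%E.
Proof.
move=> nN.
pose f (a : m.-tuple 'I_N.+1) : seq nat := [seq val x | x <- a].
have fE (a : m.-tuple 'I_N.+1) : (\sum_(i < m) tnth a i)%N = sumn (f a).
  by rewrite sumnE big_map big_tuple.
rewrite -big_filter -(big_map f xpredT F).
apply: perm_big; apply: uniq_perm; last 1 first.
- move=> c; rewrite mem_compositions; apply/mapP/idP.
    move=> [a]; rewrite mem_filter fE => /andP[/eqP sa _] ->.
    by rewrite sa eqxx andbT /f size_map size_tuple.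
  move=> /andP[/eqP sc /eqP sn].
  have sz : size [seq (inord i : 'I_N.+1) | i <- c] == m by rewrite size_map sc.
  have E : c = f (Tuple sz).
    rewrite /f /= -map_comp map_id_in // => i ic /=.
    rewrite inordK // ltnS (leq_trans _ nN) // -sn.
    by rewrite sumnE (big_rem i) //= leq_addr.
  by exists (Tuple sz); rewrite // mem_filter fE -E sn eqxx mem_index_enum.
- rewrite map_inj_uniq ?filter_uniq ?index_enum_uniq //.
  by move=> a b /(inj_map val_inj) /val_inj.
- exact: uniq_compositions.
Qed.

Lemma big_compositions1 n F : (\sum_(c <- compositions 1 n) F c = F [:: n])%E.
Proof.
rewrite compositionsS big_allpairs_dep -[n.+1 in LHS]addn1 iotaD big_cat /= big_seq1.
rewrite subnn big_seq1 big_seq big1 ?add0e // => a; rewrite mem_iota add0n /=.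
by rewrite -subn_gt0; case: (n - a)%N => //= k; rewrite big_nil.
Qed.

Lemma big_compositions_index31 (g h : seq nat -> seq nat) H m :
  (forall a b c, size c = m -> g [:: a, b & c] =
     nseq a 2%N ++ 3%N :: nseq b 2%N ++ 1%N :: h c) ->
  (forall n F, (\sum_(c <- compositions m n) F (h c) = \sum_(c <- H n) F c)%E) ->
  forall n F, (\sum_(c <- compositions m.+2 n) F (g c) =
    \sum_(c <- twos_cons 3 (twos_cons 1 H) n) F c)%E.
Proof.
move=> gE HE n F; rewrite big_twos_cons big_allpairs_dep /index_iota subn0.
apply: eq_bigr => a _; rewrite big_twos_cons big_allpairs_dep /index_iota subn0.
apply: eq_bigr => b _.
rewrite -(HE _ (fun c => F (nseq a 2 ++ 3 :: nseq b 2 ++ 1 :: c)%N)).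
rewrite !big_seq; apply: eq_bigr => c; rewrite mem_compositions => /andP[/eqP sc _].
by rewrite gE.
Qed.

Lemma big_compositions_even d n F :
  (\sum_(c <- compositions d.*2 n) F (index31 c) = \sum_(c <- half31 d.*2 n) F c)%E.
Proof.
elim: d n F => [|d IH] n F; first by case: n => [|n]; rewrite /= ?big_seq1 ?big_nil.
exact: big_compositions_index31.
Qed.

Lemma big_compositions_odd d n F :
  (\sum_(c <- compositions d.*2.+1 n) F (index31 c) = \sum_(c <- full31 d n) F c)%E.
Proof.
elim: d n F => [|d IH] n F; first by rewrite big_compositions1 big_seq1.
exact: big_compositions_index31.
Qed.

Lemma big_compositions_incr d n F :
  (\sum_(c <- compositions d.*2.+1 n) F (index31 (incr_nth c d.*2)) =
   \sum_(c <- half31 d.*2.+1 n) F c)%E.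
Proof.
elim: d n F => [|d IH] n F; first by rewrite big_compositions1 /= big_seq1.
apply: (big_compositions_index31 (g := fun c => index31 (incr_nth c d.+1.*2))
  (h := fun c => index31 (incr_nth c d.*2))) => //.
Qed.

(** The last block of twos is empty or not; this is Zstar = Zstar0 + Zstar1 at the
level of indices, and it is inherited when strings are put in front. *)
Lemma full31_split d (F : seq nat -> \bar R) :
  (\sum_(c <- full31 d 0) F c = \sum_(c <- half31 d.*2 0) F c)%E /\
  forall n, (\sum_(c <- full31 d n.+1) F c =
    \sum_(c <- half31 d.*2 n.+1) F c + \sum_(c <- half31 d.*2.+1 n) F c)%E.
Proof.
pose split H0 H1 H2 := forall F,
  (\sum_(c <- H0 0%N) F c = \sum_(c <- H1 0%N) F c)%E /\
  forall n, (\sum_(c <- H0 n.+1) F c =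
    \sum_(c <- H1 n.+1) F c + \sum_(c <- H2 n) F c)%E.
have twos_cons_split v H0 H1 H2 :
    split H0 H1 H2 -> split (twos_cons v H0) (twos_cons v H1) (twos_cons v H2).
  move=> HS {}F; split=> [|n]; first by rewrite !big_twos_cons !big_nat1 (HS _).1.
  rewrite !big_twos_cons big_nat_recr //= subnn (HS _).1.
  rewrite [X in (_ = X + _)%E]big_nat_recr //= subnn -addeA.
  rewrite [X in (_ = _ + X)%E]addeC addeA.
  rewrite -big_split /=; congr (_ + _)%E; apply: eq_big_nat => a /andP[_ an].
  by rewrite subSn // (HS _).2.
move: F; elim: d => [|d IH] F.
  split=> [|n] /=; first by [].
  by rewrite !big_seq1 big_nil add0e.
exact: (twos_cons_split 3 _ _ _ (twos_cons_split 1%N _ _ _ IH)).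
Qed.

Lemma Zstar0E d n : Zstar0 R d n = (\sum_(c <- half31 d.*2 n) zeta_star R c)%E.
Proof. by rewrite -big_compositions_even -(@big_tuple_compositions _ n n _ (leqnn n)). Qed.

Lemma ZstarE d n : Zstar R d n = (\sum_(c <- full31 d n) zeta_star R c)%E.
Proof. by rewrite -big_compositions_odd -(@big_tuple_compositions _ n n _ (leqnn n)). Qed.

Lemma Zstar1E d n : Zstar1 R d n.+1 =
  (\sum_(c <- half31 d.*2.+1 n) zeta_star R c)%E.
Proof. by rewrite -big_compositions_incr -(@big_tuple_compositions _ n.+1 n _ (leqnSn n)). Qed.

End Families.

(** * Recurrences for the generating functions *)

Section Generating.
Variable R : realType.
Implicit Types (H : nat -> seq (seq nat)) (f g h : nat -> nat -> R).

Definition starsums H n K : R := \sum_(c <- H n) starsum R c K.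

Lemma starsums_ge0 H n K : 0 <= starsums H n K.
Proof. by apply: sumr_ge0 => c _; exact: starsum_ge0. Qed.

Lemma starsums_le H n : {homo starsums H n : K L / (K <= L)%N >-> K <= L}.
Proof. by move=> K L KL; apply: ler_sum => c _; exact: starsum_le. Qed.

Lemma starsums_twos_cons0 v H n : starsums (twos_cons v H) n 0 = 0.
Proof.
rewrite /starsums big_twos_cons big1 // => a _; rewrite big1 // => c _.
by case: a => [|a]; exact: starsum0.
Qed.

(** The terms with k_1 = K+1: the first entry is a 2 and one 2 fewer remains, or
the first block is empty and the first entry is v. *)
Lemma starsums_twos_consS v H n K :
  starsums (twos_cons v H) n K.+1 = starsums (twos_cons v H) n K +
    (if n is n'.+1 then K.+1%:R ^- 2 * starsums (twos_cons v H) n' K.+1 else 0) +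
    K.+1%:R ^- v * starsums H n K.+1.
Proof.
have hd L : \sum_(c <- H n) starsum R (v :: c) L.+1 =
    \sum_(c <- H n) starsum R (v :: c) L + L.+1%:R ^- v * starsums H n L.+1.
  rewrite /starsums mulr_sumr -big_split /=; apply: eq_bigr => c _.
  exact: starsumS.
case: n hd => [|n] hd; rewrite /starsums !big_twos_cons.
  by rewrite !big_nat1 /= hd addr0.
rewrite !(big_nat_recl n.+1) //= subn0 hd -!addrA; congr (_ + _).
rewrite addrC addrA; congr (_ + _).
rewrite mulr_sumr -big_split /=; apply: eq_bigr => a _.
rewrite subSS mulr_sumr -big_split /=; apply: eq_bigr => c _.
exact: (starsumS R 2 (nseq a 2%N ++ v :: c)).
Qed.

Section Homogeneous.
Variables x y : R.

(** The part of degree m of the generating function of f in y (exponent j) and x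
(exponent n). *)
Definition homog f m := \sum_(j < m.+1) y ^+ j * x ^+ (m - j) * f j (m - j)%N.

Lemma homog0 f : homog f 0 = f 0%N 0%N.
Proof. by rewrite /homog big_ord1 !expr0 !mul1r. Qed.

Lemma homogS f m : homog f m.+1 = x ^+ m.+1 * f 0%N m.+1 + y * homog (f \o S) m.
Proof.
rewrite /homog big_ord_recl /= expr0 mul1r subn0 mulr_sumr; congr (_ + _).
by apply: eq_bigr => j _; rewrite /bump /= add1n subSS exprS !mulrA.
Qed.

Lemma homog_rec f g h a m :
  (forall j n, f j n = g j n + (if n is n'.+1 then a * f j n' else 0) + h j n) ->
  homog f m.+1 = homog g m.+1 + a * x * homog f m + homog h m.+1.
Proof.
move=> E; rewrite /homog !(big_ord_recr m.+1) /= !subnn !expr0 !mulr1.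
rewrite [f m.+1 _]E addr0 [X in X + _](_ : _ =
  (\sum_(j < m.+1) y ^+ j * x ^+ (m.+1 - j) * g j (m.+1 - j)%N) +
  a * x * (\sum_(j < m.+1) y ^+ j * x ^+ (m - j) * f j (m - j)%N) +
  \sum_(j < m.+1) y ^+ j * x ^+ (m.+1 - j) * h j (m.+1 - j)%N); first by ring.
rewrite mulr_sumr -!big_split /=; apply: eq_bigr => j _.
rewrite [f j (m.+1 - j)%N]E subSn -1?ltnS // exprS.
by rewrite /=; ring.
Qed.

Definition outer_sum m K := homog (fun j n => starsums (half31 j) n K) m.
(** These indices start with {2}^a, 1: they are what is left of {2}^b, 3, {2}^a, 1,
... when its first 3 and the twos before it are removed. *)
Definition inner_sum m K := homog (fun j n => starsums (twos_cons 1 (half31 j)) n K) m.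

Lemma starsums_half310 n K : starsums (half31 0) n K = (n == 0%N)%:R.
Proof. by case: n => [|n]; rewrite /starsums /= ?big_seq1 ?big_nil. Qed.

Lemma outer_sum0 K : outer_sum 0 K = 1.
Proof. by rewrite /outer_sum homog0 starsums_half310. Qed.

Let f1 K := (fun j n => starsums (half31 j.+1) n K).

Lemma outer_sumE m K : outer_sum m.+1 K = y * homog (f1 K) m.
Proof. by rewrite /outer_sum homogS starsums_half310 mulr0 add0r. Qed.

Let h1 K j n : R :=
  if j is j'.+1 then K.+1%:R ^- 3 * starsums (twos_cons 1 (half31 j')) n K.+1
  else K.+1%:R ^- 2 * (n == 0%N)%:R.

Lemma f1E K j n : f1 K.+1 j n = f1 K j n +
  (if n is n'.+1 then K.+1%:R ^- 2 * f1 K.+1 j n' else 0) + h1 K j n.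
Proof.
rewrite /f1 /h1; case: j => [|j]; last exact: starsums_twos_consS.
case: n => [|n]; rewrite /starsums ![half31 1 _]/= !big_seq1.
  by rewrite (starsumS R 2 [::]) /= mulr1 addr0.
by rewrite mulr0 addr0; exact: (starsumS R 2 (nseq n.+1 2%N)).
Qed.

Lemma outer_sum1 K : outer_sum 1 K.+1 = outer_sum 1 K + y / K.+1%:R ^+ 2.
Proof. by rewrite !outer_sumE !homog0 f1E /= mulr1 addr0 mulrDr. Qed.

Lemma outer_sum_rec m K : outer_sum m.+2 K.+1 = outer_sum m.+2 K +
  x / K.+1%:R ^+ 2 * outer_sum m.+1 K.+1 + y ^+ 2 / K.+1%:R ^+ 3 * inner_sum m K.+1.
Proof.
rewrite !outer_sumE (homog_rec _ (f1E K)) [homog (h1 K) m.+1]homogS /= mulr0 mulr0 add0r.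
have -> : homog (h1 K \o S) m = K.+1%:R ^- 3 * inner_sum m K.+1.
  by rewrite /inner_sum /homog mulr_sumr; apply: eq_bigr => j _ /=; ring.
by ring.
Qed.

Lemma inner_sum0 K : inner_sum 0 K.+1 = inner_sum 0 K + K.+1%:R^-1.
Proof.
by rewrite /inner_sum !homog0 starsums_twos_consS addr0 starsums_half310 mulr1 expr1.
Qed.

Lemma inner_sum_rec m K : inner_sum m.+1 K.+1 = inner_sum m.+1 K +
  x / K.+1%:R ^+ 2 * inner_sum m K.+1 + outer_sum m.+1 K.+1 / K.+1%:R.
Proof.
rewrite /inner_sum (homog_rec _ (fun j n => starsums_twos_consS 1 (half31 j) n K)).
have -> : homog (fun j n => K.+1%:R ^- 1 * starsums (half31 j) n K.+1) m.+1 =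
   outer_sum m.+1 K.+1 / K.+1%:R.
  by rewrite /outer_sum /homog mulr_suml; apply: eq_bigr => j _; rewrite expr1; ring.
by ring.
Qed.

Lemma inner_sum_at0 m : inner_sum m 0 = 0.
Proof. by rewrite /inner_sum /homog big1 // => j _; rewrite starsums_twos_cons0 mulr0. Qed.

Lemma outer_sum_at0 m : outer_sum m.+1 0 = 0.
Proof.
rewrite outer_sumE /homog big1 ?mulr0 // => -[[|j] hj] _ /=.
  by rewrite /f1 /starsums [half31 1 _]/= big_seq1 (starsum0 R 2) mulr0.
by rewrite /f1 /= starsums_twos_cons0 mulr0.
Qed.

End Homogeneous.
End Generating.

(** * Solution of the recurrences by a summation kernel *)

Section Kernel.
Variable R : realType.
Implicit Types (n k : nat) (s : nat -> R).

(** n!^2 / ((n-k)! (n+k)!), written as a product so that it vanishes for k > n. *)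
Definition ckernel n k : R := \prod_(i < k) ((n%:R - i%:R) / (n%:R + i.+1%:R)).

Lemma ckernel0 n : ckernel n 0 = 1.
Proof. by rewrite /ckernel big_ord0. Qed.

Lemma ckernelS n k :
  (n%:R + k.+1%:R) * ckernel n k.+1 = (n%:R - k%:R) * ckernel n k.
Proof.
have h : n%:R + k.+1%:R != 0 :> R by rewrite -natrD pnatr_eq0 addnS.
by rewrite /ckernel big_ord_recr /= mulrCA [_ * (_ / _)]mulrC divfK // mulrC.
Qed.

Lemma ckernel_gt n k : (n < k)%N -> ckernel n k = 0.
Proof.
move=> nk; rewrite /ckernel (bigD1 (Ordinal nk)) //= subrr mul0r mul0r //.
Qed.

(** Equivalently c(n+1,k) - c(n,k) = k^2 c(n+1,k) / (n+1)^2, so that summing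
c(m,k) / m^2 over m multiplies the kernel by 1 / k^2. *)
Lemma ckernel_pred n k :
  ckernel n k * n.+1%:R ^+ 2 = ckernel n.+1 k * (n.+1%:R ^+ 2 - k%:R ^+ 2).
Proof.
elim: k => [|k IH]; first by rewrite !ckernel0 expr0n subr0.
have h : n%:R + k.+1%:R != 0 :> R by rewrite -natrD pnatr_eq0 addnS.
apply: (mulfI h).
have E1 := ckernelS n k; have E2 := ckernelS n.+1 k.
rewrite mulrA E1.
have -> : (n%:R - k%:R) * ckernel n k * n.+1%:R ^+ 2 =
          (n%:R - k%:R) * (ckernel n k * n.+1%:R ^+ 2) by ring.
rewrite IH.
have -> : (n%:R + k.+1%:R) *
    (ckernel n.+1 k.+1 * (n.+1%:R ^+ 2 - k.+1%:R ^+ 2)) =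
   (n%:R + k.+1%:R) * (n%:R - k%:R) *
    ((n.+1%:R + k.+1%:R) * ckernel n.+1 k.+1) :> R.
  rewrite -!natr1; ring.
rewrite E2 -!natr1; ring.
Qed.

Lemma ckernel_ge0 n k : 0 <= ckernel n k.
Proof.
have [kn|nk] := leqP k n; last by rewrite ckernel_gt.
apply: prodr_ge0 => i _; apply: divr_ge0; last by rewrite -natrD.
by rewrite subr_ge0 ler_nat ltnW // (leq_trans (ltn_ord i)).
Qed.

Lemma ckernel_le n k : ckernel n k.+1 <= ckernel n k.
Proof.
have [kn|nk] := leqP n k; first by rewrite ckernel_gt // ckernel_ge0.
rewrite /ckernel big_ord_recr /= -[leRHS]mulr1; apply: ler_wpM2l.
  exact: ckernel_ge0.
rewrite ler_pdivrMr ?mul1r; last by rewrite -natrD ltr0n addnS.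
by have : 0 <= k%:R :> R by []; rewrite -natr1; lra.
Qed.

Lemma cvg_ckernel k : (fun n => ckernel n k) @ \oo --> (1 : R).
Proof.
elim: k => [|k IH].
  by under eq_fun do rewrite ckernel0; exact: cvg_cst.
under eq_fun do rewrite /ckernel big_ord_recr /= -/(ckernel _ _).
suff H : (fun n : nat => (n%:R - k%:R) / (n%:R + k.+1%:R) : R) @ \oo --> (1 : R).
  have := cvgM IH H; rewrite mulr1; exact.
have -> : (fun n : nat => (n%:R - k%:R) / (n%:R + k.+1%:R) : R) =
          (fun n => 1 - (k + k.+1)%:R * (n + k.+1)%:R^-1).
  apply/funext => n; have h : (n + k.+1)%:R != 0 :> R.
    by rewrite pnatr_eq0 addnS.
  apply: (mulIf h); rewrite [RHS]mulrBl divfK // -natrD divfK //.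
  by rewrite mul1r !natrD -natr1; ring.
have H : (fun n : nat => (n + k.+1)%:R^-1 : R) @ \oo --> (0 : R).
  have := @cvg_harmonic R; rewrite -(cvg_shiftn k) /harmonic /=.
  by under eq_fun do rewrite -addnS.
have := cvgB (cvg_cst (1 : R)) (cvgM (cvg_cst ((k + k.+1)%:R : R)) H).
rewrite mulr0 subr0; exact.
Qed.

(** For s 0 = 1 this is the average of s with weights c(n,k) - c(n,k+1), after
summation by parts. *)
Definition cmean s n : R := 1 + \sum_(k < n) (s k.+1 - s k) * ckernel n k.+1.

Lemma cmeanE s n : s 0%N = 1 ->
  cmean s n = \sum_(k < n.+1) s k * (ckernel n k - ckernel n k.+1).
Proof.
move=> s0; rewrite /cmean.
have H m : \sum_(k < m.+1) s k * (ckernel n k - ckernel n k.+1) =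
   1 + \sum_(k < m) (s k.+1 - s k) * ckernel n k.+1 - s m * ckernel n m.+1.
  elim: m => [|m IH].
    by rewrite big_ord1 big_ord0 s0 ckernel0; ring.
  by rewrite big_ord_recr /= IH big_ord_recr /=; ring.
by rewrite H ckernel_gt // mulr0 subr0.
Qed.

(** The weights are nonnegative with sum 1, and each of them tends to 0 as n
grows, so averaging preserves limits. *)
Lemma cvg_cmean s (l : R) : s 0%N = 1 -> s @ \oo --> l -> cmean s @ \oo --> l.
Proof.
move=> s0 sl; apply/cvgrPdist_le => e e0.
have e20 : 0 < e / 2 by rewrite divr_gt0.
have [k0 _ Hk0] : \forall k \near \oo, `|l - s k| <= e / 2.
  by move/cvgrPdist_le : sl; exact.
have [M [M0 HM]] : exists M : R, 0 < M /\ forall k, `|l - s k| <= M.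
  exists (\sum_(k < k0) `|l - s k| + e); split=> [|k].
    by rewrite ltr_wpDl // sumr_ge0.
  have [kk|kk] := ltnP k k0.
    rewrite (bigD1 (Ordinal kk)) //= -addrA lerDl addr_ge0 ?sumr_ge0 //.
    exact: ltW.
  rewrite (le_trans (Hk0 _ kk)) // (@le_trans _ _ e) //; first by lra.
  by rewrite lerDr sumr_ge0.
have eM : 0 < e / 2 / M by rewrite divr_gt0.
have [n1 _ Hn1] : \forall n \near \oo, `|1 - ckernel n k0| <= e / 2 / M.
  by have /cvgrPdist_le := @cvg_ckernel k0; exact.
exists (maxn n1 k0) => // n /=; rewrite geq_max => /andP[n1n k0n].
have sumw m : \sum_(k < m) (ckernel n k - ckernel n k.+1) = 1 - ckernel n m.
  elim: m => [|m IH]; first by rewrite big_ord0 ckernel0 subrr.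
  by rewrite big_ord_recr /= IH; ring.
have -> : l - cmean s n =
    \sum_(k < n.+1) (l - s k) * (ckernel n k - ckernel n k.+1).
  rewrite cmeanE //; under [RHS]eq_bigr do rewrite mulrBl.
  by rewrite sumrB -mulr_sumr sumw ckernel_gt // subr0 mulr1.
have w0 k : 0 <= ckernel n k - ckernel n k.+1 by rewrite subr_ge0 ckernel_le.
rewrite (le_trans (ler_norm_sum _ _ _)) //.
have -> : e = e / 2 + e / 2 by lra.
rewrite -(big_mkord xpredT (fun k => `|(l - s k) * (ckernel n k - ckernel n k.+1)|)).
rewrite (@big_cat_nat _ _ _ k0) //=; last exact: leqW.
apply: lerD.
  apply: (@le_trans _ _ (\sum_(0 <= k < k0) M * (ckernel n k - ckernel n k.+1))).
    apply: ler_sum => k _; rewrite normrM (ger0_norm (w0 k)).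
    by rewrite ler_wpM2r.
  rewrite -mulr_sumr big_mkord sumw mulrC -ler_pdivlMr //.
  by rewrite (le_trans (ler_norm _)) // Hn1.
apply: (@le_trans _ _ (\sum_(k0 <= k < n.+1) e / 2 * (ckernel n k - ckernel n k.+1))).
  rewrite !big_nat; apply: ler_sum => k /andP[kk _].
  rewrite normrM (ger0_norm (w0 k)) ler_wpM2r //; exact: Hk0.
rewrite -mulr_sumr -[leRHS]mulr1 ler_wpM2l ?(ltW e20) //.
apply: (@le_trans _ _ (\sum_(0 <= k < n.+1) (ckernel n k - ckernel n k.+1))).
  rewrite [leRHS](@big_cat_nat _ _ _ k0) //=; last exact: leqW.
  by rewrite lerDr sumr_ge0.
by rewrite big_mkord sumw ckernel_gt // subr0.
Qed.

Section Recurrence.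
Variables (x y : R) (s : nat -> R).
Hypothesis s0 : s 0%N = 1.
Hypothesis x1 : x < 1.
Hypothesis srec : forall k, (k.+1%:R ^+ 2 - x) * (s k.+1 - s k) =
  (-1) ^+ k * y * (s k.+1 + s k).

(** The companion F of T = cmean s: n T(n) is the combination of the kernels
c(n,k+1) with coefficients (k+1) (s_(k+1) + s_k), and the second equation of the
system divides these by (k+1)^2 - x. *)
Definition cmean_dual n : R :=
  \sum_(k < n) k.+1%:R * (s k.+1 + s k) / (k.+1%:R ^+ 2 - x) * ckernel n k.+1.

Let den k : k.+1%:R ^+ 2 - x != 0.
Proof.
rewrite gt_eqF // subr_gt0 (lt_le_trans x1) // expr_ge1 //.
by rewrite ler1n.
Qed.

(** By ckernel_pred the left-hand side is a combination of the c(n+1,k) whose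
coefficients simplify by the recurrence of s.  Comparing it with the companion
amounts to multiplying kernels by n+1, where the sum telescopes. *)
Lemma cmean_rec n :
  cmean s n.+1 * (1 - x / n.+1%:R ^+ 2) - cmean s n =
  (y - x) / n.+1%:R ^+ 2 + y ^+ 2 / n.+1%:R ^+ 3 * cmean_dual n.+1.
Proof.
set N : R := n.+1%:R; have N0 : N != 0 by rewrite pnatr_eq0.
(* By ckernelS the summands are differences of consecutive values of
   (-1)^k s_k (N - k) c(N,k), and this vanishes at k = N. *)
have tele m : N * (\sum_(k < m) (-1) ^+ k * (s k.+1 + s k) * ckernel n.+1 k.+1)
   - \sum_(k < m) (-1) ^+ k * k.+1%:R * (s k.+1 - s k) * ckernel n.+1 k.+1
   = N - (-1) ^+ m * (s m * (N - m%:R) * ckernel n.+1 m).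
  elim: m => [|m IH].
    by rewrite !big_ord0 s0 ckernel0 expr0; ring.
  rewrite !big_ord_recr /= mulrDr opprD addrACA IH exprS.
  have E := ckernelS n.+1 m; rewrite -/N in E.
  have -> : s m * (N - m%:R) * ckernel n.+1 m =
            s m * ((N - m%:R) * ckernel n.+1 m) by ring.
  rewrite -E; ring.
have := tele n.+1; rewrite subrr mulr0 mul0r mulr0 subr0 => {}tele.
have yF : y * cmean_dual n.+1 =
   \sum_(k < n.+1) (-1) ^+ k * k.+1%:R * (s k.+1 - s k) * ckernel n.+1 k.+1.
  rewrite mulr_sumr; apply: eq_bigr => k _.
  apply: (mulfI (den k)); rewrite !mulrA.
  have -> : (k.+1%:R ^+ 2 - x) * (-1) ^+ k * k.+1%:R * (s k.+1 - s k) *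
       ckernel n.+1 k.+1 = (-1) ^+ k * k.+1%:R * ((k.+1%:R ^+ 2 - x) * 
       (s k.+1 - s k)) * ckernel n.+1 k.+1 by ring.
  rewrite srec.
  have E : (-1) ^+ k * (-1) ^+ k = 1 :> R by rewrite -exprMn mulrNN mulr1 expr1n.
  have -> : (-1) ^+ k * k.+1%:R * ((-1) ^+ k * y * (s k.+1 + s k)) *
    ckernel n.+1 k.+1 = ((-1) ^+ k * (-1) ^+ k) * (k.+1%:R * y * (s k.+1 + s k) *
    ckernel n.+1 k.+1) by ring.
  by rewrite E mul1r; field; rewrite nat1r den.
rewrite -yF in tele.
have -> : cmean s n = 1 + \sum_(k < n.+1) (s k.+1 - s k) * ckernel n k.+1.
  by rewrite big_ord_recr /= ckernel_gt // mulr0 addr0.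
rewrite [in LHS]/cmean.
have Es : \sum_(k < n.+1) (s k.+1 - s k) * ckernel n.+1 k.+1 *
    (1 - x / N ^+ 2) - \sum_(k < n.+1) (s k.+1 - s k) * ckernel n k.+1 =
   y / N ^+ 2 *
   \sum_(k < n.+1) (-1) ^+ k * (s k.+1 + s k) * ckernel n.+1 k.+1.
  rewrite -sumrB mulr_sumr; apply: eq_bigr => k _.
  have E : ckernel n k.+1 = ckernel n.+1 k.+1 * (N ^+ 2 - k.+1%:R ^+ 2) / N ^+ 2.
    by rewrite -ckernel_pred mulfK // expf_neq0.
  rewrite E.
  have aux (d c i : R) : d * c * (1 - x / N ^+ 2) -
      d * (c * (N ^+ 2 - i ^+ 2) / N ^+ 2) = (i ^+ 2 - x) * d * c / N ^+ 2.
    by field.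
  by rewrite aux srec; ring.
rewrite mulrDl opprD addrACA -mulr_suml in Es *; rewrite Es.
set A := \sum_(k < n.+1) _ in tele Es *.
have EA : A = (N + y * cmean_dual n.+1) / N.
  by move/eqP: tele; rewrite subr_eq => /eqP <-; rewrite mulrC mulKf.
by rewrite EA; field.
Qed.

Lemma cmean_dual_rec n :
  cmean_dual n.+1 * (1 - x / n.+1%:R ^+ 2) - cmean_dual n = cmean s n.+1 / n.+1%:R.
Proof.
set N : R := n.+1%:R; have N0 : N != 0 by rewrite pnatr_eq0.
have tele m : \sum_(k < m) k.+1%:R * (s k.+1 + s k) * ckernel n.+1 k.+1
   - N * (\sum_(k < m) (s k.+1 - s k) * ckernel n.+1 k.+1)
   = N - s m * (N - m%:R) * ckernel n.+1 m.
  elim: m => [|m IH].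
    by rewrite !big_ord0 s0 ckernel0; ring.
  rewrite !big_ord_recr /= [N * (_ + _)]mulrDr opprD addrACA IH.
  have E := ckernelS n.+1 m; rewrite -/N in E.
  have -> : s m * (N - m%:R) * ckernel n.+1 m =
            s m * ((N - m%:R) * ckernel n.+1 m) by ring.
  rewrite -E; ring.
have := tele n.+1; rewrite subrr mulr0 mul0r subr0 => {}tele.
have -> : cmean_dual n = \sum_(k < n.+1)
    k.+1%:R * (s k.+1 + s k) / (k.+1%:R ^+ 2 - x) * ckernel n k.+1.
  by rewrite big_ord_recr /= ckernel_gt // mulr0 addr0.
rewrite {1}/cmean_dual mulr_suml -sumrB.
transitivity ((\sum_(k < n.+1) k.+1%:R * (s k.+1 + s k) * ckernel n.+1 k.+1) / N ^+ 2).
  rewrite mulr_suml; apply: eq_bigr => k _.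
  have -> : ckernel n k.+1 = ckernel n.+1 k.+1 * (N ^+ 2 - k.+1%:R ^+ 2) / N ^+ 2.
    by rewrite -ckernel_pred mulfK // expf_neq0.
  by field; rewrite ?nat1r den N0.
move/eqP: tele; rewrite subr_eq => /eqP ->.
by rewrite /cmean; field.
Qed.

End Recurrence.
End Kernel.

(** * Convergence of the generating functions *)

Section GeneratingLimit.
Variable R : realType.

(** The system for one step in K has a positive determinant, so nonnegative data
have a nonnegative solution.  Applied to a solution and its opposite it also
gives uniqueness. *)
Lemma solve2_ge0 (p a b c A B e f : R) : 0 <= p -> 0 <= a -> 0 <= b -> 0 <= c ->
  p + a < 1 -> b * c = a ^+ 2 -> 0 <= A -> 0 <= B ->
  (1 - p) * e = A + b * f -> (1 - p) * f = B + c * e -> 0 <= e /\ 0 <= f.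
Proof.
move=> p0 a0 b0 c0 pa bc A0 B0 He Hf.
have p1 : 0 < 1 - p by lra.
have D0 : 0 < (1 - p) ^+ 2 - a ^+ 2.
  by rewrite subr_sqr mulr_gt0 //; lra.
have e0 : 0 <= e.
  rewrite -(pmulr_rge0 _ D0) -bc.
  have -> : ((1 - p) ^+ 2 - b * c) * e = (1 - p) * A + b * B.
    have -> : ((1 - p) ^+ 2 - b * c) * e = (1 - p) * ((1 - p) * e) - b * c * e by ring.
    rewrite He mulrDr mulrCA Hf; ring.
  by rewrite addr_ge0 // mulr_ge0 // ltW.
split=> //; rewrite -(pmulr_rge0 _ p1) Hf.
by rewrite addr_ge0 // mulr_ge0.
Qed.

Section Fixed.
Variables (x y : R) (T F : nat -> R).
Hypotheses (x0 : 0 < x) (y0 : 0 < y) (xy1 : x + y < 1).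
Hypotheses (T0 : T 0%N = 1) (F0 : F 0%N = 0).
Hypothesis HT : forall K, T K.+1 * (1 - x / K.+1%:R ^+ 2) - T K =
  (y - x) / K.+1%:R ^+ 2 + y ^+ 2 / K.+1%:R ^+ 3 * F K.+1.
Hypothesis HF : forall K,
  F K.+1 * (1 - x / K.+1%:R ^+ 2) - F K = T K.+1 / K.+1%:R.

Let W M K := \sum_(m < M) outer_sum x y m K.
Let V M K := \sum_(m < M) inner_sum x y m K.

Let WS M K : W M.+2 K.+1 = W M.+2 K + y / K.+1%:R ^+ 2 +
  x / K.+1%:R ^+ 2 * (W M.+1 K.+1 - 1) + y ^+ 2 / K.+1%:R ^+ 3 * V M K.+1.
Proof.
rewrite /W /V; elim: M => [|M IH].
  rewrite !big_ord_recr !big_ord0 /= !outer_sum0 outer_sum1; ring.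
rewrite [LHS]big_ord_recr /= outer_sum_rec [X in X + _ = _]IH [in RHS]big_ord_recr /=.
rewrite [\sum_(m < M.+2) outer_sum x y m K.+1]big_ord_recr /=.
rewrite [\sum_(m < M.+1) inner_sum x y m K.+1]big_ord_recr /=; ring.
Qed.

Let VS M K : V M.+1 K.+1 = V M.+1 K + x / K.+1%:R ^+ 2 * V M K.+1 +
  W M.+1 K.+1 / K.+1%:R.
Proof.
rewrite /W /V; elim: M => [|M IH].
  rewrite !big_ord_recr !big_ord0 /= outer_sum0 inner_sum0; ring.
rewrite [LHS]big_ord_recr /= inner_sum_rec [X in X + _ = _]IH [in RHS]big_ord_recr /=.
rewrite [\sum_(m < M.+2) outer_sum x y m K.+1]big_ord_recr /=.
rewrite [\sum_(m < M.+1) inner_sum x y m K.+1]big_ord_recr /=; ring.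
Qed.

Lemma outer_sum_ge0 m K : 0 <= outer_sum x y m K.
Proof.
apply: sumr_ge0 => j _; rewrite mulr_ge0 ?starsums_ge0 // mulr_ge0 //.
  by rewrite exprn_ge0 // ltW.
by rewrite exprn_ge0 // ltW.
Qed.

Lemma inner_sum_ge0 m K : 0 <= inner_sum x y m K.
Proof.
apply: sumr_ge0 => j _; rewrite mulr_ge0 ?starsums_ge0 // mulr_ge0 //.
  by rewrite exprn_ge0 // ltW.
by rewrite exprn_ge0 // ltW.
Qed.

Let coefs K (N := K.+1%:R : R) : [/\ 0 <= x / N ^+ 2, 0 <= y / N ^+ 2,
  0 <= y ^+ 2 / N ^+ 3, 0 <= N^-1 & 
  x / N ^+ 2 + y / N ^+ 2 < 1 /\
  y ^+ 2 / N ^+ 3 * N^-1 = (y / N ^+ 2) ^+ 2].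
Proof.
have N0 : 0 < N by rewrite ltr0n.
have N1 : 1 <= N by rewrite ler1n.
have x0' := ltW x0; have y0' := ltW y0; have N0' := ltW N0.
split.
- by rewrite divr_ge0 // exprn_ge0.
- by rewrite divr_ge0 // exprn_ge0.
- by rewrite divr_ge0 // exprn_ge0.
- by rewrite invr_ge0.
split; last by field; rewrite gt_eqF.
rewrite -mulrDl ltr_pdivrMr ?exprn_gt0 // mul1r (lt_le_trans xy1) //.
exact: exprn_ege1.
Qed.

Let TF K : 1 <= T K /\ 0 <= F K.
Proof.
elim: K => [|K [IT IF]]; first by rewrite T0 F0.
have [p0 a0 b0 c0 [pa bc]] := coefs K.
have A0 : 0 <= T K - 1 + y / K.+1%:R ^+ 2 by rewrite addr_ge0 // subr_ge0.
have B0 : 0 <= F K + K.+1%:R^-1 by rewrite addr_ge0.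
have := solve2_ge0 p0 a0 b0 c0 pa bc A0 B0 (e := T K.+1 - 1) (f := F K.+1).
rewrite subr_ge0; apply.
  move/eqP: (HT K); rewrite subr_eq => /eqP E.
  rewrite mulrBr mulr1 mulrC E; ring.
move/eqP: (HF K); rewrite subr_eq => /eqP E.
by rewrite mulrC E; ring.
Qed.

Let bound K : forall M, W M K <= T K /\ V M K <= F K.
Proof.
elim: K => [|K IH].
  have W1 M : W M.+1 0 = 1.
    rewrite /W big_ord_recl outer_sum0 big1 ?addr0 // => m _.
    by rewrite /= outer_sum_at0.
  have V0 M : V M 0 = 0 by rewrite /V big1 // => m _; rewrite inner_sum_at0.
  by case=> [|M]; rewrite V0 ?W1 T0 F0 // /W big_ord0 ler01.
have [p0 a0 b0 c0 _] := coefs K; have [T1 F1] := TF K.+1.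
have H M : W M.+1 K.+1 <= T K.+1 /\ V M K.+1 <= F K.+1.
  elim: M => [|M [IW IV]].
    by rewrite /W /V big_ord_recr !big_ord0 /= add0r outer_sum0.
  have [IW' _] := IH M.+2; have [_ IV'] := IH M.+1.
  split.
    rewrite WS; move/eqP: (HT K); rewrite subr_eq mulrBr mulr1 subr_eq => /eqP ->.
    have := ler_wpM2l p0 IW; have := ler_wpM2l b0 IV; rewrite mulrBl mulrBr mulr1.
    rewrite [T _ * _]mulrC.
    by move: (x / _) (y / _ ^+ 2) (y ^+ 2 / _) => p a b; lra.
  rewrite VS; move/eqP: (HF K); rewrite subr_eq mulrBr mulr1 subr_eq => /eqP ->.
  have := ler_wpM2l p0 IV; have := ler_wpM2r c0 IW; rewrite [F _ * _]mulrC.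
  by move: (x / _) (T _ / _) (W _ _ / _) => p a b; lra.
case=> [|M]; last by split; [exact: (H M).1 | exact: (H M.+1).2].
split; first by rewrite /W big_ord0 (le_trans ler01).
by rewrite /V big_ord0.
Qed.

(** All coefficients being nonnegative, the partial sums over the degree stay below
any solution of the system that starts from T 0 = 1 and F 0 = 0. *)
Lemma outer_sum_partial_le M K : \sum_(m < M) outer_sum x y m K <= T K.
Proof. exact: (bound K M).1. Qed.

Let nondec (u : nat -> nat -> R) K : (forall m, 0 <= u m K) ->
  nondecreasing_seq (fun M => \sum_(m < M) u m K).
Proof.
move=> u0; apply/nondecreasing_seqP => M.
by rewrite big_ord_recr /= lerDl.
Qed.

(** The partial sums increase and are bounded, and their limits satisfy the same
system as T and F, whose solution is unique. *)
Lemma cvg_outer_sum K : (fun M => \sum_(m < M) outer_sum x y m K) @ \oo --> T K.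
Proof.
suff : W^~ K @ \oo --> T K /\ V^~ K @ \oo --> F K by case.
elim: K => [|K [IW IV]].
  split.
    rewrite -(cvg_shiftS (W^~ 0%N)).
    have -> : (fun M => W M.+1 0%N) = fun=> 1.
      apply/funext => M; rewrite /W big_ord_recl outer_sum0 big1 ?addr0 // => m _.
      by rewrite /= outer_sum_at0.
    by rewrite T0; exact: cvg_cst.
  have -> : (fun M => V M 0%N) = fun=> 0.
    by apply/funext => M; rewrite /V big1 // => m _; rewrite inner_sum_at0.
  by rewrite F0; exact: cvg_cst.
have cW : cvgn (W^~ K.+1).
  apply: nondecreasing_is_cvgn; first by apply: nondec => m; exact: outer_sum_ge0.
  by exists (T K.+1) => _ [M _ <-]; exact: (bound K.+1 M).1.
have cV : cvgn (V^~ K.+1).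
  apply: nondecreasing_is_cvgn; first by apply: nondec => m; exact: inner_sum_ge0.
  by exists (F K.+1) => _ [M _ <-]; exact: (bound K.+1 M).2.
have {cW}[lW cW] : exists l : R, W^~ K.+1 @ \oo --> l by exists (limn (W^~ K.+1)).
have {cV}[lV cV] : exists l : R, V^~ K.+1 @ \oo --> l by exists (limn (V^~ K.+1)).
have sh (u : nat -> R) (l : R) : u @ \oo --> l -> (fun M => u M.+1) @ \oo --> l.
  by rewrite cvg_shiftS.
have EW : lW = T K + y / K.+1%:R ^+ 2 + x / K.+1%:R ^+ 2 * (lW - 1) +
    y ^+ 2 / K.+1%:R ^+ 3 * lV.
  have c2 : (fun M => W M.+2 K.+1) @ \oo --> lW.
    by apply: (sh (fun M => W M.+1 K.+1)); exact: (sh (W^~ K.+1)).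
  apply: (cvg_unique _ c2) => //; rewrite (funext (WS^~ K)).
  apply: cvgD; first apply: cvgD; first apply: cvgD.
  - by apply: (sh (fun M => W M.+1 K)); exact: (sh (W^~ K)).
  - exact: cvg_cst.
  - by apply: cvgM; [exact: cvg_cst | apply: cvgB; [exact: (sh (W^~ K.+1)) | exact: cvg_cst]].
  - by apply: cvgM; [exact: cvg_cst | ].
have EV : lV = F K + x / K.+1%:R ^+ 2 * lV + lW / K.+1%:R.
  have c1 : (fun M => V M.+1 K.+1) @ \oo --> lV by exact: (sh (V^~ K.+1)).
  apply: (cvg_unique _ c1) => //; rewrite (funext (VS^~ K)).
  apply: cvgD; first apply: cvgD.
  - exact: (sh (V^~ K)).
  - by apply: cvgM; [exact: cvg_cst | ].
  - by apply: cvgM; [exact: (sh (W^~ K.+1)) | exact: cvg_cst].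
have [p0 a0 b0 c0 [pa bc]] := coefs K.
have z0 : 0 <= 0 :> R by [].
have := HT K; have := HF K => HFK HTK.
have E1 : (1 - x / K.+1%:R ^+ 2) * (T K.+1 - lW) =
   0 + y ^+ 2 / K.+1%:R ^+ 3 * (F K.+1 - lV).
  move: HTK EW; rewrite mulrBl.
  by move: (x / _) (y / _ ^+ 2) (y ^+ 2 / _) => p a b; lra.
have E2 : (1 - x / K.+1%:R ^+ 2) * (F K.+1 - lV) =
   0 + K.+1%:R^-1 * (T K.+1 - lW).
  move: HFK EV; move: (x / _) (K.+1%:R^-1) => p b; lra.
have [e1 f1] := solve2_ge0 p0 a0 b0 c0 pa bc z0 z0 E1 E2.
have E1' : (1 - x / K.+1%:R ^+ 2) * - (T K.+1 - lW) =
   0 + y ^+ 2 / K.+1%:R ^+ 3 * - (F K.+1 - lV).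
  by rewrite mulrN E1 mulrN !add0r.
have E2' : (1 - x / K.+1%:R ^+ 2) * - (F K.+1 - lV) =
   0 + K.+1%:R^-1 * - (T K.+1 - lW).
  by rewrite mulrN E2 mulrN !add0r.
have [e2 f2] := solve2_ge0 p0 a0 b0 c0 pa bc z0 z0 E1' E2'.
have -> : T K.+1 = lW by lra.
have -> : F K.+1 = lV by lra.
by [].
Qed.

(** The coefficients increase with K and are bounded by a bound of T divided by
their monomial. *)
Lemma cvg_starsums_half31 j n (L : R) : T @ \oo --> L -> cvgn (starsums R (half31 j) n).
Proof.
move=> TL; apply: nondecreasing_is_cvgn => [K M KM|]; first exact: starsums_le.
have [B HB] := cvg_has_ub (cvgP _ TL).
exists (B / (y ^+ j * x ^+ n)) => _ [K _ <-].
have c0 : 0 < y ^+ j * x ^+ n by rewrite mulr_gt0 ?exprn_gt0.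
rewrite ler_pdivlMr // mulrC.
apply: (@le_trans _ _ (outer_sum x y (j + n) K)).
  have jn : (j < (j + n).+1)%N by rewrite ltnS leq_addr.
  rewrite /outer_sum /homog (bigD1 (Ordinal jn)) //= addKn lerDl.
  apply: sumr_ge0 => i _; rewrite mulr_ge0 ?starsums_ge0 // mulr_ge0 //.
    by rewrite exprn_ge0 // ltW.
  by rewrite exprn_ge0 // ltW.
apply: (@le_trans _ _ (T K)).
  apply: le_trans (outer_sum_partial_le (j + n).+1 K).
  by rewrite big_ord_recr /= lerDr sumr_ge0 // => m _; exact: outer_sum_ge0.
by apply: (le_trans (ler_norm _)); apply: HB; exists K.
Qed.

Definition star_lim j n : R := limn (starsums R (half31 j) n).

(** Monotone convergence: the sum over the degree and the limit in K of
nonnegative increasing terms can be exchanged. *)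
Lemma cvg_homog_star_lim (L : R) : T @ \oo --> L ->
  (fun M => \sum_(m < M) homog x y star_lim m) @ \oo --> L.
Proof.
move=> TL.
have cw m : outer_sum x y m @ \oo --> homog x y star_lim m.
  rewrite /outer_sum /homog; apply: cvg_big => [|j _]; first exact: add_continuous.
  apply: cvgM; first exact: cvg_cst.
  exact: cvg_starsums_half31 TL.
have wle m K : outer_sum x y m K <= homog x y star_lim m.
  apply: cvgr_to_ge (cw m) _; near=> K'.
  apply: ler_sum => j _; apply: ler_wpM2l.
    by rewrite mulr_ge0 // exprn_ge0 // ltW.
  by apply: starsums_le; near: K'; exact: nbhs_infty_ge.
pose S M := \sum_(m < M) homog x y star_lim m.
have SL M : S M <= L.
  have cS : (fun K => \sum_(m < M) outer_sum x y m K) @ \oo --> S M.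
    by apply: cvg_big => [|m _]; [exact: add_continuous | exact: cw].
  apply: (ler_cvg_to cS TL); near=> K; exact: outer_sum_partial_le.
have ndS : nondecreasing_seq S.
  apply/nondecreasing_seqP => M; rewrite /S big_ord_recr /= lerDl.
  by apply: le_trans (wle M 0%N); exact: outer_sum_ge0.
have cS : cvgn S.
  by apply: nondecreasing_is_cvgn => //; exists L => _ [M _ <-].
suff -> : L = limn S by [].
apply/eqP; rewrite eq_le; apply/andP; split; last first.
  by apply: limr_le => //; near=> M; exact: SL.
apply: (cvgr_to_le TL); near=> K.
apply: (cvgr_to_le (@cvg_outer_sum K)); near=> M.
apply: le_trans (nondecreasing_cvgn_le ndS cS M).
by apply: ler_sum => m _.
Unshelve. all: by end_near. Qed.

End Fixed.

End GeneratingLimit.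

(** * Euler's product for the sine *)

Section SineProduct.
Variable R : realType.
Implicit Types x v : R.

Lemma sin_half x : sin x = 2 * sin (x / 2) * cos (x / 2).
Proof.
have E : x / 2 *+ 2 = x by rewrite -[LHS]mulr_natr divfK.
by rewrite -[in LHS]E sin_mulr2n -[LHS]mulr_natl [cos _ * _]mulrC mulrA.
Qed.

Lemma cos_half x : cos x = 1 - 2 * sin (x / 2) ^+ 2.
Proof.
have E : x / 2 *+ 2 = x by rewrite -[LHS]mulr_natr divfK.
by rewrite -[in LHS]E cos_mulr2n cos2sin2; ring.
Qed.

Definition dyad (n : nat) : R := 2^-1 ^+ n.+1.

Lemma dyadS n : dyad n.+1 = dyad n / 2.
Proof. by rewrite /dyad exprSr. Qed.

Lemma dyad_gt0 n : 0 < dyad n.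
Proof. by rewrite exprn_gt0 // invr_gt0. Qed.

Lemma dyad_pihalf n : (2 ^ n)%:R * (pi * dyad n) = pi / 2 :> R.
Proof.
have h : 2 ^+ n * 2^-1 ^+ n = 1 :> R by rewrite -exprMn mulfV ?expr1n.
rewrite natrX /dyad exprSr.
have -> : 2 ^+ n * (pi * (2^-1 ^+ n / 2)) = (2 ^+ n * 2^-1 ^+ n) * (pi / 2) :> R by ring.
by rewrite h mul1r.
Qed.

Definition sin_factor x n k : R := 1 - (sin (x * dyad n) / sin (k%:R * (pi * dyad n))) ^+ 2.

Lemma sin_dyad_gt0 n k : (0 < k)%N -> (k < 2 ^ n)%N ->
  0 < k%:R * (pi * dyad n) < pi / 2.
Proof.
move=> k0 kn; have p0 : 0 < pi * dyad n :> R by rewrite mulr_gt0 ?pi_gt0 ?dyad_gt0.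
by rewrite mulr_gt0 ?ltr0n //= -(dyad_pihalf n) ltr_pM2r // ltr_nat.
Qed.

(** Doubling the number of factors: 1 - sin(2u)^2 / sin(2v)^2 is the product of
1 - sin(u)^2 / sin(w)^2 over w = v and w = pi/2 - v, and the double angles in
front produce the remaining factor, for w = pi/4. *)
Lemma sin_product x n : sin x =
  2 ^+ n.+1 * sin (x * dyad n) * cos (x * dyad n) *
  \prod_(1 <= k < 2 ^ n) sin_factor x n k.
Proof.
elim: n => [|n IH].
  by rewrite big_geq // mulr1 expr1 /dyad expr1 -sin_half.
rewrite [LHS]IH; set u := x * dyad n.+1.
have uE : x * dyad n / 2 = u by rewrite /u dyadS mulrA.
have su : sin (x * dyad n) = 2 * sin u * cos u by rewrite sin_half uE.
have cu : cos (x * dyad n) = 1 - 2 * sin u ^+ 2 by rewrite cos_half uE.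
set p : R := pi * dyad n.+1.
have q0 : (0 < 2 ^ n)%N by rewrite expn_gt0.
have le2 : (2 ^ n <= 2 ^ n.+1)%N by rewrite leq_exp2l.
have pq : (2 ^ n.+1)%:R * p = pi / 2 by exact: dyad_pihalf.
have pq2 : (2 ^ n)%:R * p = pi / 2 / 2.
  by rewrite -pq expnS natrM; field.
have fac k : (0 < k)%N -> (k < 2 ^ n)%N ->
    sin_factor x n k = sin_factor x n.+1 k * sin_factor x n.+1 (2 ^ n.+1 - k).
  move=> k0 kn; rewrite /sin_factor -/u -/p su.
  have /andP[v0 v1] := @sin_dyad_gt0 n.+1 k k0 (leq_trans kn le2).
  rewrite -/p in v0 v1.
  have -> : k%:R * (pi * dyad n) = 2 * (k%:R * p) by rewrite /p dyadS; field.
  rewrite natrB; last by rewrite ltnW // (leq_trans kn).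
  have -> : ((2 ^ n.+1)%:R - k%:R) * p = pi / 2 - k%:R * p by rewrite mulrBl pq.
  set v := k%:R * p in v0 v1 *.
  have sv : 0 < sin v by rewrite sin_gt0_pihalf // v0 v1.
  have cv : 0 < cos v by rewrite cos_gt0_pihalf // v1 andbT; lra.
  have -> : sin (pi / 2 - v) = cos v by rewrite -[LHS]opprK -sinN opprB sinBpihalf opprK.
  have -> : sin (2 * v) = 2 * sin v * cos v.
    by rewrite sin_half; congr (2 * sin _ * cos _); field.
  have Cu := cos2sin2 u; have Cv := cos2sin2 v.
  have sv0 := lt0r_neq0 sv; have cv0 := lt0r_neq0 cv.
  rewrite !expr_div_n !exprMn Cu.
  transitivity ((sin v ^+ 2 * cos v ^+ 2 - sin u ^+ 2 * (1 - sin u ^+ 2)) /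
      (sin v ^+ 2 * cos v ^+ 2)).
    by field; rewrite sv0 cv0.
  have -> : sin v ^+ 2 * cos v ^+ 2 - sin u ^+ 2 * (1 - sin u ^+ 2) = 
    (sin v ^+ 2 - sin u ^+ 2) * (cos v ^+ 2 - sin u ^+ 2) by rewrite Cv; ring.
  by field; rewrite sv0 cv0.
have mid : sin_factor x n.+1 (2 ^ n) = 1 - 2 * sin u ^+ 2.
  rewrite /sin_factor -/u -/p pq2.
  have E : sin (pi / 2 / 2) ^+ 2 = 2^-1 :> R.
    have := cos_half (pi / 2 : R); rewrite cos_pihalf; lra.
  by rewrite expr_div_n E invrK mulrC.
have -> : \prod_(1 <= k < 2 ^ n.+1) sin_factor x n.+1 k =
   (1 - 2 * sin u ^+ 2) * \prod_(1 <= k < 2 ^ n) sin_factor x n k.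
  rewrite expnS mul2n -addnn (@big_cat_nat _ _ _ (2 ^ n)) //=; last by rewrite leq_addr.
  rewrite [X in _ * X]big_ltn; last by lia.
  rewrite mid mulrCA; congr (_ * _).
  rewrite (big_addn 1 (2 ^ n + 2 ^ n) (2 ^ n)) addnK [X in _ * X]big_nat_rev -big_split /=.
  apply: eq_big_nat => k /andP[k0 kn]; rewrite fac //; congr (_ * sin_factor _ _ _).
  by rewrite expnS; lia.
rewrite su cu [2 ^+ n.+2]exprS; ring.
Qed.

Lemma sin_ge_half v : 0 <= v <= pi / 2 -> v / 2 <= sin v.
Proof.
move=> /andP[v0 v1]; have [->|vN0] := eqVneq v 0; first by rewrite mul0r sin0.
set w := v / 2; have vw : v = 2 * w by rewrite /w; field.
have w0 : 0 < w by rewrite divr_gt0 // lt0r vN0.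
have pi0 : (0 : R) < pi := pi_gt0 R.
have [c] : exists2 c, c \in `]0, w[ & sin w - sin 0 = cos c * (w - 0).
  apply: MVT => //; apply: continuous_subspaceT => x; exact: continuous_sin.
rewrite in_itv /= sin0 !subr0 => /andP[c0 cw] Esin.
have Hc : cos w <= cos c.
  apply: ltW; rewrite ltr_cos // in_itv /=; apply/andP; split; lra.
have C0 : 0 <= cos v by rewrite cos_ge0_pihalf // v1 andbT; lra.
have Cw : 2^-1 <= cos w ^+ 2.
  by rewrite cos2sin2; move: C0; rewrite cos_half -/w; lra.
have cw0 : 0 <= cos w by rewrite cos_ge0_pihalf //; apply/andP; split; lra.
rewrite sin_half -/w Esin.
have : cos w * cos w <= cos c * cos w by rewrite ler_wpM2r.
rewrite -expr2 => Hcc.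
have : w * 2^-1 <= w * (cos c * cos w).
  by apply: ler_wpM2l; [exact: ltW | exact: le_trans Hcc].
lra.
Qed.

Lemma cvg_sin_div : sin h / h @[h --> (0 : R)^'] --> (1 : R).
Proof.
have /cvg_ex[l Hl] := @derivable_sin R 0.
have [_ D] := is_derive_sin (0 : R).
rewrite /derive (cvg_lim _ Hl) // cos0 in D.
rewrite -D; apply: cvg_trans Hl; apply: near_eq_cvg.
by near=> h; rewrite sin0 subr0 /= addr0 [h%:A]mulr1 [RHS]mulrC.
Unshelve. all: by end_near. Qed.

Lemma cvg_dyad : dyad @ \oo --> (0 : R).
Proof.
have h : `|2^-1 : R| < 1 by rewrite ger0_norm //; lra.
have := cvg_expr h; rewrite -cvg_shiftS; exact.
Qed.

Lemma cvg_sin_dyad c : c != 0 ->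
  (fun n => sin (c * dyad n) / dyad n) @ \oo --> c.
Proof.
move=> c0.
have E : (fun n => sin (c * dyad n) / dyad n) =
    (fun n => c * (sin (c * dyad n) / (c * dyad n))).
  apply/funext => n; have d0 := lt0r_neq0 (dyad_gt0 n).
  by field; rewrite c0 d0.
rewrite E.
have H : (fun n => sin (c * dyad n) / (c * dyad n)) @ \oo --> (1 : R).
  apply: (proj1 (cvgr_dnbhsP _ _ _) cvg_sin_div); split.
    by move=> n; rewrite mulf_neq0 // lt0r_neq0 // dyad_gt0.
  by have := cvgM (cvg_cst c) cvg_dyad; rewrite mulr0; exact.
by have := cvgM (cvg_cst c) H; rewrite mulr1; exact.
Qed.

Definition eulerprod x K : R := \prod_(1 <= k < K.+1) (1 - (x / (k%:R * pi)) ^+ 2).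

(** The lower bound does not depend on n and makes the tail of the product
uniformly close to 1. *)
Lemma sin_factor_range x n k : 0 < x <= 1 -> (0 < k)%N -> (k < 2 ^ n)%N ->
  [/\ 0 <= sin_factor x n k, sin_factor x n k <= 1 & 1 - (k%:R ^+ 2)^-1 <= sin_factor x n k].
Proof.
move=> /andP[x0 x1] k0 kn.
have /andP[v0 v1] := sin_dyad_gt0 k0 kn.
have d0 := dyad_gt0 n; have k1 : (1 : R) <= k%:R by rewrite ler1n.
have pi2 : (2 : R) <= pi := pi_ge2 R.
set v := k%:R * (pi * dyad n) in v0 v1 *; set u := x * dyad n.
have u0 : 0 < u by rewrite mulr_gt0.
have kd : k%:R * u * 2 <= v.
  rewrite /v /u -mulrA ler_wpM2l // mulrAC ler_wpM2r ?(ltW d0) //; lra.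
have uk : u <= k%:R * u by rewrite ler_peMl // ltW.
have uv : u <= v by lra.
have su0 : 0 < sin u by rewrite sin_gt0_pihalf // u0 /=; lra.
have sv0 : 0 < sin v by rewrite sin_gt0_pihalf // v0.
have su : sin u <= u.
  have [c] : exists2 c, c \in `]0, u[ & sin u - sin 0 = cos c * (u - 0).
    apply: MVT => //; apply: continuous_subspaceT => y; exact: continuous_sin.
  rewrite sin0 !subr0 => _ ->; rewrite ler_piMl ?(ltW u0) //; exact: cos_le1.
have sv : k%:R * u <= sin v.
  apply: le_trans (sin_ge_half _); last by rewrite !ltW.
  by rewrite ler_pdivlMr.
have r0 : 0 <= sin u / sin v by rewrite divr_ge0 // ltW.
have rk : sin u / sin v <= k%:R^-1.
  rewrite ler_pdivrMr // mulrC ler_pdivlMr ?ltr0n // mulrC.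
  by apply: le_trans sv; rewrite ler_wpM2l.
have rk2 : (sin u / sin v) ^+ 2 <= (k%:R ^+ 2)^-1.
  by rewrite -exprVn; apply: lerXn2r rk; rewrite nnegrE // invr_ge0.
have r20 : 0 <= (sin u / sin v) ^+ 2 by rewrite exprn_ge0.
have kk : (k%:R ^+ 2)^-1 <= (1 : R).
  by rewrite invf_le1 ?exprn_gt0 ?ltr0n // exprn_ege1.
rewrite /sin_factor -/u -/v; split; lra.
Qed.

Lemma cvg_sin_factor x k : x != 0 -> (0 < k)%N ->
  (fun n => sin_factor x n k) @ \oo --> 1 - (x / (k%:R * pi)) ^+ 2.
Proof.
move=> x0 k0; have kp0 : k%:R * pi != 0 :> R.
  by rewrite mulf_neq0 ?pnatr_eq0 -?lt0n // gt_eqF // pi_gt0.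
apply: cvgB; first exact: cvg_cst.
have E : (fun n => (sin (x * dyad n) / sin (k%:R * (pi * dyad n))) ^+ 2) =
  (fun n => ((sin (x * dyad n) / dyad n) / (sin (k%:R * pi * dyad n) / dyad n)) ^+ 2).
  apply/funext => n; have d0 := lt0r_neq0 (dyad_gt0 n).
  congr (_ ^+ 2); rewrite [k%:R * (_ * _)]mulrA invf_div.
  by rewrite [RHS]mulrA divfK.
have H : (fun n => (sin (x * dyad n) / dyad n) / (sin (k%:R * pi * dyad n) / dyad n))
    @ \oo --> x / (k%:R * pi).
  apply: cvgM; first exact: cvg_sin_dyad.
  by apply: cvgV => //; exact: cvg_sin_dyad.
by rewrite E expr2; under eq_fun do rewrite expr2; exact: cvgM.
Qed.

Lemma cvg_head x K : x != 0 ->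
  (fun n => 2 ^+ n.+1 * sin (x * dyad n) * cos (x * dyad n) *
     \prod_(1 <= k < K.+1) sin_factor x n k) @ \oo --> x * eulerprod x K.
Proof.
move=> x0.
have E : (fun n => 2 ^+ n.+1 * sin (x * dyad n) * cos (x * dyad n) *
     \prod_(1 <= k < K.+1) sin_factor x n k) =
  (fun n => sin (x * dyad n) / dyad n * cos (x * dyad n) *
     \prod_(1 <= k < K.+1) sin_factor x n k).
  apply/funext => n; congr (_ * _ * _); rewrite mulrC; congr (_ * _).
  by rewrite /dyad exprVn invrK.
rewrite E; apply: cvgM; last first.
  rewrite /eulerprod big_nat; under eq_fun do rewrite big_nat.
  apply: cvg_big => [|k /andP[k0 _]]; first exact: mul_continuous.
  exact: cvg_sin_factor.
have Hs := cvg_sin_dyad x0.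
have Hc : (fun n => cos (x * dyad n)) @ \oo --> (1 : R).
  have H : (fun n => x * dyad n) @ \oo --> (0 : R).
    by have := cvgM (cvg_cst x) cvg_dyad; rewrite mulr0; exact.
  suff : cos \o (fun n => x * dyad n) @ \oo --> cos (0 : R) by rewrite cos0.
  by apply: (cvg_comp _ _ H); exact: continuous_cos.
by have := cvgM Hs Hc; rewrite mulr1; exact.
Qed.

Lemma telescope_prod K M : (0 < K)%N -> (K < M)%N ->
  \prod_(K.+1 <= k < M) (1 - (k%:R ^+ 2)^-1) =
  K%:R * M%:R / (K.+1%:R * M.-1%:R) :> R.
Proof.
move=> K0; elim: M => // M IH; rewrite ltnS leq_eqVlt => /orP[/eqP <-|KM].
  rewrite big_geq // [in RHS]/= [K%:R * _]mulrC divff // mulf_neq0 ?pnatr_eq0 //.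
  by rewrite -lt0n.
rewrite big_nat_recr //= IH //.
have M0 : (0 < M)%N by apply: leq_trans KM.
have M1 : (0 < M.-1)%N by rewrite -subn1 subn_gt0 (leq_trans _ KM).
have := M1; rewrite -(prednK M0); set m := M.-1 => m0 /=.
have : m%:R != 0 :> R by rewrite pnatr_eq0 -lt0n.
have : m.+1%:R != 0 :> R by rewrite pnatr_eq0.
have : K.+1%:R != 0 :> R by rewrite pnatr_eq0.
rewrite -!natr1 => h1 h2 h3; field; rewrite ?h1 ?h2 ?h3 //.
Qed.

(** In the finite product the factors lie in [0,1], so dropping the tail bounds
sin x from above; the tail is at least K / (K+1), which bounds it from below.
Letting n grow with K fixed gives x P_K K / (K+1) <= sin x <= x P_K for the
partial products P_K. *)
Lemma cvg_eulerprod x : 0 < x <= 1 -> eulerprod x @ \oo --> sin x / x.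
Proof.
move=> x01; have /andP[x0 x1] := x01; have xN0 := lt0r_neq0 x0.
have pi2 : (2 : R) <= pi := pi_ge2 R.
have big K : exists n0 : nat, forall n, (n0 <= n)%N -> (K.+1 < 2 ^ n)%N.
  exists K.+1 => n Kn; apply: (leq_trans (ltn_expl K.+1 (ltnSn 1))).
  by rewrite leq_exp2l.
have pre0 n : 0 <= 2 ^+ n.+1 * sin (x * dyad n) * cos (x * dyad n).
  have d0 := dyad_gt0 n; have d1 : dyad n <= 2^-1.
    rewrite /dyad exprS ler_piMr ?invr_ge0 // exprn_ile1 // ?invr_ge0 //.
    by rewrite invf_le1 // ler1n.
  have u0 : 0 < x * dyad n by rewrite mulr_gt0.
  have u1 : x * dyad n <= 2^-1 by apply: le_trans d1; rewrite ler_piMl // ltW.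
  rewrite !mulr_ge0 ?exprn_ge0 //.
    by rewrite ltW // sin_gt0_pihalf // u0 /=; move: pi2 u1; lra.
  by rewrite cos_ge0_pihalf //; apply/andP; split; lra.
have split_ n K : (K.+1 < 2 ^ n)%N -> sin x =
   2 ^+ n.+1 * sin (x * dyad n) * cos (x * dyad n) *
   \prod_(1 <= k < K.+1) sin_factor x n k * \prod_(K.+1 <= k < 2 ^ n) sin_factor x n k.
  move=> Kn; rewrite [LHS](sin_product x n).
  by rewrite (@big_cat_nat _ _ _ K.+1) //= ?mulrA // ltnW.
have upper K : sin x <= x * eulerprod x K.
  apply: cvgr_to_ge (@cvg_head x K xN0) _; have [n0 Hn0] := big K.
  exists n0 => // n /= /Hn0 Kn; rewrite (split_ n K Kn) ler_piMr //.
    rewrite mulr_ge0 // big_nat; apply: prodr_ge0 => k /andP[k0 kK].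
    by have [] := @sin_factor_range x n k x01 k0 (ltn_trans kK Kn).
  rewrite big_nat; apply: prodr_ile1 => k /andP[k0 kK].
  have [-> ->//] := @sin_factor_range x n k x01 (leq_trans (ltn0Sn K) k0) kK.
have lower K : (0 < K)%N -> x * eulerprod x K * (K%:R / K.+1%:R) <= sin x.
  move=> K0; apply: cvgr_to_le (cvgM (@cvg_head x K xN0) (cvg_cst _)) _.
  have [n0 Hn0] := big K.
  exists n0 => // n /= /Hn0 Kn; rewrite [leRHS](split_ n K Kn) ler_wpM2l //.
    rewrite mulr_ge0 // big_nat; apply: prodr_ge0 => k /andP[k0 kK].
    by have [] := @sin_factor_range x n k x01 k0 (ltn_trans kK Kn).
  apply: (@le_trans _ _ (\prod_(K.+1 <= k < 2 ^ n) (1 - (k%:R ^+ 2)^-1))).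
    rewrite telescope_prod //; last exact: ltnW.
    rewrite invfM mulrACA ler_peMr //.
    rewrite ler_pdivlMr ?ltr0n ?mul1r ?ler_nat ?leq_pred //.
    by move: Kn; clear; lia.
  rewrite !big_nat; apply: ler_prod => k /andP[k0 kK].
  have k1 := leq_trans (ltn0Sn K) k0.
  have [_ _ ->] := @sin_factor_range x n k x01 k1 kK; rewrite andbT.
  by rewrite subr_ge0 invf_le1 ?exprn_gt0 ?ltr0n // exprn_ege1 // ler1n.
have cK : (fun K => sin x / x * (1 + K.+1%:R^-1)) @ \oo --> sin x / x.
  have := cvgM (cvg_cst (sin x / x)) (cvgD (cvg_cst (1 : R)) (@cvg_harmonic R)).
  by rewrite addr0 mulr1; exact.
rewrite -cvg_shiftS; apply: (squeeze_cvgr _ (cvg_cst (sin x / x)) cK).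
near=> K; apply/andP; split; first by rewrite ler_pdivrMr // mulrC upper.
have xK0 : 0 < x * (K.+1%:R / K.+2%:R) by rewrite mulr_gt0 // divr_gt0.
rewrite -(ler_pM2l xK0); have := lower K.+1 isT; rewrite mulrAC => /le_trans; apply.
rewrite le_eqVlt; apply/orP; left; apply/eqP.
have k1 : K.+1%:R != 0 :> R by rewrite pnatr_eq0.
have : K.+1%:R + 1 != 0 :> R by rewrite natr1 pnatr_eq0.
rewrite -[K.+2%:R]natr1; move: (K.+1%:R) k1 => p p0 p1.
by field; rewrite xN0 p0 p1.
Unshelve. all: by end_near. Qed.

End SineProduct.

(** * The limit as a quotient of cotangents *)

Section Limit.
Variable R : realType.
Implicit Types (X x y : R) (k : nat).

Definition sqprod X k : R := \prod_(1 <= i < k.+1) (1 - X / i%:R ^+ 2).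

Lemma sqprodS X k : sqprod X k.+1 = sqprod X k * (1 - X / k.+1%:R ^+ 2).
Proof. by rewrite /sqprod big_nat_recr. Qed.

Lemma sqfac_gt0 X k : X < 1 -> 0 < 1 - X / k.+1%:R ^+ 2.
Proof.
move=> X1; have N1 : 1 <= k.+1%:R ^+ 2 :> R by rewrite exprn_ege1 // ler1n.
have N0 : 0 < k.+1%:R ^+ 2 :> R by apply: lt_le_trans N1.
by rewrite subr_gt0 ltr_pdivrMr // mul1r (lt_le_trans X1).
Qed.

Lemma sqprod_gt0 X k : X < 1 -> 0 < sqprod X k.
Proof.
move=> X1; elim: k => [|k IH]; first by rewrite /sqprod big_geq.
by rewrite sqprodS mulr_gt0 ?sqfac_gt0.
Qed.

(** The product of 1 - X/i^2 over odd i <= k divided by the same product over even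
i <= k: dividing twice by the even factors, which are those of X/4. *)
Definition altprod X k : R := sqprod X k / sqprod (X / 4) k./2 ^+ 2.

Lemma altprod0 X : altprod X 0 = 1.
Proof. by rewrite /altprod /sqprod !big_geq // expr1n divr1. Qed.

Lemma altprod_gt0 X k : X < 1 -> 0 < altprod X k.
Proof.
move=> X1; rewrite divr_gt0 ?sqprod_gt0 // exprn_gt0 // sqprod_gt0 //; lra.
Qed.

Lemma altprodS X k : X < 1 -> altprod X k.+1 =
  altprod X k * (if odd k then (1 - X / k.+1%:R ^+ 2)^-1
                 else 1 - X / k.+1%:R ^+ 2).
Proof.
move=> X1; have hE : k.+1./2 = (odd k + k./2)%N := uphalf_half k.
rewrite /altprod hE; case: ifPn => ok; last by rewrite sqprodS mulrAC.
have [j kj] : exists j, k.+1 = (j.+1).*2.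
  by exists k./2; rewrite doubleS -[in LHS](odd_double_half k) ok.
have -> : k./2 = j by move: hE; rewrite kj doubleK ok => -[].
rewrite !sqprodS kj.
have -> : X / 4 / j.+1%:R ^+ 2 = X / j.+1.*2%:R ^+ 2.
  rewrite -mulrA -invfM; congr (_ / _).
  by rewrite -mul2n natrM exprMn; congr (_ * _); ring.
have h : 1 - X / j.+1.*2%:R ^+ 2 != 0.
  by rewrite doubleS; apply: lt0r_neq0; exact: sqfac_gt0.
have h2 : sqprod (X / 4) j != 0 by apply/lt0r_neq0/sqprod_gt0; lra.
by move: (1 - _) (sqprod _ j) h h2 => p q p0 q0; field; rewrite p0 q0.
Qed.

(** The determinant of the system at step k is (k^2 - x)^2 - y^2 up to the factor
k^4; it vanishes for k^2 = x - y and k^2 = x + y, whence the two products. *)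
Definition sigma x y k : R := altprod (x - y) k / altprod (x + y) k.

Lemma sigma0 x y : sigma x y 0 = 1.
Proof. by rewrite /sigma !altprod0 divr1. Qed.

(** With N = k+1, the quotient of the two consecutive values is
(N^2 - x + y) / (N^2 - x - y) or its inverse, according to parity. *)
Lemma sigma_rec x y k : 0 < y -> x + y < 1 ->
  (k.+1%:R ^+ 2 - x) * (sigma x y k.+1 - sigma x y k) =
  (-1) ^+ k * y * (sigma x y k.+1 + sigma x y k).
Proof.
move=> y0 xy1; have xy1' : x - y < 1 by lra.
have N0 : k.+1%:R != 0 :> R by rewrite pnatr_eq0.
have qa0 := lt0r_neq0 (altprod_gt0 k xy1'); have qb0 := lt0r_neq0 (altprod_gt0 k xy1).
have fa0 := lt0r_neq0 (sqfac_gt0 k xy1'); have fb0 := lt0r_neq0 (sqfac_gt0 k xy1).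
rewrite /sigma !altprodS // -[(-1) ^+ k]signr_odd.
move: (k.+1%:R) (altprod _ _) (altprod _ _) N0 qa0 qb0 fa0 fb0 => N p q N0 p0 q0 fa0 fb0.
have fa : N ^+ 2 - (x - y) != 0.
  apply: contra_neq fa0 => /eqP; rewrite subr_eq0 => /eqP <-.
  by rewrite divff ?subrr // expf_neq0.
have fb : N ^+ 2 - (x + y) != 0.
  apply: contra_neq fb0 => /eqP; rewrite subr_eq0 => /eqP <-.
  by rewrite divff ?subrr // expf_neq0.
have -> : 1 - (x - y) / N ^+ 2 = (N ^+ 2 - (x - y)) / N ^+ 2 by field.
have -> : 1 - (x + y) / N ^+ 2 = (N ^+ 2 - (x + y)) / N ^+ 2 by field.
by case: odd; rewrite /= ?expr1 ?expr0; field; rewrite N0 ?p0 ?q0 /= ?fa ?fb.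
Qed.

Lemma cvg_half (u : nat -> R) (l : R) :
  u @ \oo --> l -> (fun k => u k./2) @ \oo --> l.
Proof.
move=> ul P /ul[n _ Hn]; exists n.*2 => // k /= nk; apply: Hn => /=.
by rewrite -(doubleK n) half_leq.
Qed.

Definition xcot x : R := x * cos x / sin x.

Lemma sqprodE x k : sqprod (x ^+ 2) k = eulerprod (pi * x) k.
Proof.
rewrite /sqprod /eulerprod !big_nat; apply: eq_bigr => i /andP[i0 _].
have i0' : i%:R != 0 :> R by rewrite pnatr_eq0 -lt0n.
have p0 : pi != 0 :> R by rewrite gt_eqF // pi_gt0.
rewrite -expr_div_n; move: (pi : R) p0 => p p0.
by congr (1 - _ ^+ 2); field; rewrite i0' p0.
Qed.

Lemma pi_lt4 : (pi : R) < 4.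
Proof. by have := pihalf_lt2 R; lra. Qed.

(** Euler's product at pi x and at pi x / 2, with the double angle formula. *)
Lemma cvg_altprod x : 0 < x <= 4^-1 ->
  altprod (x ^+ 2) @ \oo --> xcot (pi * x / 2).
Proof.
move=> /andP[x0 x1]; have p0 : (0 : R) < pi := pi_gt0 R.
have p2 : (2 : R) <= pi := pi_ge2 R.
have p4 := pi_lt4; have px0 : 0 < pi * x by rewrite mulr_gt0.
have px1 : pi * x <= 1.
  have : pi * x <= 4 * x by rewrite ler_wpM2r // ltW.
  lra.
set A := pi * x / 2; have A0 : 0 < A by rewrite divr_gt0.
have A1 : A <= 2^-1 by rewrite /A; lra.
have sA : 0 < sin A by rewrite sin_gt0_pihalf // A0 /=; lra.
have c1 : sqprod (x ^+ 2) @ \oo --> sin (pi * x) / (pi * x).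
  by rewrite (funext (sqprodE x)); apply: cvg_eulerprod; rewrite px0.
have c2 : (fun k => sqprod (x ^+ 2 / 4) k./2) @ \oo --> sin A / A.
  apply: (cvg_half (u := sqprod (x ^+ 2 / 4))).
  have -> : x ^+ 2 / 4 = (x / 2) ^+ 2 by field.
  rewrite (funext (sqprodE (x / 2))) mulrA; apply: cvg_eulerprod.
  by rewrite -/A A0 /=; lra.
have -> : xcot A = sin (pi * x) / (pi * x) / (sin A / A * (sin A / A)).
  have -> : pi * x = 2 * A by rewrite /A [RHS]mulrC divfK.
  rewrite sin_half; have -> : 2 * A / 2 = A by rewrite [2 * A]mulrC mulfK.
  by rewrite /xcot; field; rewrite (lt0r_neq0 sA) (lt0r_neq0 A0).
apply: cvgM => //; apply: cvgV.
  by rewrite mulf_neq0 // mulf_neq0 ?invr_neq0 // lt0r_neq0.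
by under eq_fun do rewrite expr2; exact: cvgM.
Qed.

Lemma cvg_sigma (a b x y : R) : 0 < a <= 4^-1 -> 0 < b <= 4^-1 ->
  x - y = a ^+ 2 -> x + y = b ^+ 2 ->
  sigma x y @ \oo --> xcot (pi * a / 2) / xcot (pi * b / 2).
Proof.
move=> Ha Hb Ea Eb; rewrite /sigma Ea Eb; apply: cvgM; first exact: cvg_altprod.
apply: cvgV; last exact: cvg_altprod.
move: Hb => /andP[b0 b1]; have p0 : (0 : R) < pi := pi_gt0 R.
have p2 : (2 : R) <= pi := pi_ge2 R.
have p4 := pi_lt4; have pb0 : 0 < pi * b by rewrite mulr_gt0.
have pb1 : pi * b <= 1.
  have : pi * b <= 4 * b by rewrite ler_wpM2r // ltW.
  lra.
have c0 : 0 < cos (pi * b / 2) by apply: cos_gt0_pihalf; apply/andP; split; lra.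
have s0 : 0 < sin (pi * b / 2) by apply: sin_gt0_pihalf; apply/andP; split; lra.
by rewrite lt0r_neq0 // divr_gt0 // mulr_gt0 //; lra.
Qed.

Lemma cvg_homog_xcot (a b x y : R) : 0 < a <= 4^-1 -> 0 < b <= 4^-1 ->
  x - y = a ^+ 2 -> x + y = b ^+ 2 -> 0 < y ->
  (forall j n, cvgn (starsums R (half31 j) n)) /\
  (fun M => \sum_(m < M) homog x y (star_lim R) m) @ \oo -->
    xcot (pi * a / 2) / xcot (pi * b / 2).
Proof.
move=> Ha Hb Ea Eb y0.
have xy1 : x + y < 1.
  rewrite Eb; case/andP: Hb => b0 b1.
  apply: (@le_lt_trans _ _ (4^-1 ^+ 2)); last by rewrite expr2; lra.
  by apply: lerXn2r => //; rewrite nnegrE ltW.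
have a20 : 0 < a ^+ 2 by case/andP: Ha => a0 _; rewrite exprn_gt0.
have x0 : 0 < x by lra.
have x1 : x < 1 by lra.
have srec k := sigma_rec k y0 xy1.
have s0 := sigma0 x y.
have T0 : cmean (sigma x y) 0 = 1 by rewrite /cmean big_ord0 addr0.
have F0 : cmean_dual x (sigma x y) 0 = 0 by rewrite /cmean_dual big_ord0.
have HT := cmean_rec s0 x1 srec.
have HF := @cmean_dual_rec _ x (sigma x y) s0 x1.
have TL := cvg_cmean s0 (cvg_sigma Ha Hb Ea Eb).
split; first by move=> j n; exact: cvg_starsums_half31 HT HF j n _ TL.
exact: cvg_homog_star_lim HT HF _ TL.
Qed.

End Limit.

(** * Power series near zero *)

Section PowerSeries.
Variable R : realType.
Implicit Types (u v w : nat -> R) (f g : R -> R).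

Definition cauchyprod u v m : R := \sum_(i < m.+1) u i * v (m - i)%N.

(** Power series at 0 are only tested at small positive arguments, because they
will be used in the variable t^2. *)
Definition has_pseries u f : Prop :=
  \forall s \near (0 : R)^'+, pseries u s @ \oo --> f s.

Lemma near_right (P : R -> Prop) : (\forall s \near (0 : R)^'+, P s) <->
  exists2 e, 0 < e & forall s, 0 < s < e -> P s.
Proof.
split=> [[e /= e0 He]|[e e0 He]].
  exists e => // s /andP[s0 se]; apply: He => //.
  by rewrite /ball_ /= sub0r normrN gtr0_norm.
exists e => //= s; rewrite /ball_ /= sub0r normrN => se s0; apply: He.
by rewrite s0 /= (le_lt_trans (ler_norm s)).
Qed.

Lemma sum_triangle (F : nat -> nat -> R) N :
  \sum_(m < N) \sum_(i < m.+1) F i (m - i)%N =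
  \sum_(i < N) \sum_(j < N - i) F i j.
Proof.
elim: N => [|N IH]; first by rewrite !big_ord0.
rewrite big_ord_recr /= IH [in RHS]big_ord_recr /= subSn // subnn big_ord1.
rewrite [in X in _ + X]big_ord_recr /= subnn addrA; congr (_ + _).
rewrite -big_split /=; apply: eq_bigr => i _.
by rewrite subSn ?big_ord_recr // ltnW.
Qed.

Lemma pseries_growth u (l s : R) : 0 < s -> pseries u s @ \oo --> l ->
  exists2 C : R, 0 <= C & forall n, `|u n| <= C * s^-1 ^+ n.
Proof.
move=> s0 ul; have [C HC] := cvg_has_ub (cvgP _ (cvg_series_cvg_0 (cvgP _ ul))).
exists C; first by apply: le_trans (HC `|u 0%N * s ^+ 0| _); [|exists 0%N].
move=> n; rewrite exprVn ler_pdivlMr ?exprn_gt0 //.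
have -> : `|u n| * s ^+ n = `|u n * s ^+ n|.
  by rewrite normrM [`|s ^+ n|]ger0_norm // exprn_ge0 // ltW.
by apply: HC; exists n.
Qed.

(** The difference between the product of the partial sums of order N and the
partial sum of the product has at most N^2 <= 4^N terms, each at most C^2 q^N. *)
Lemma cvg_cauchyprod (C q l l' : R) u v : 0 <= C -> 0 <= q -> 4 * q < 1 ->
  (forall n, `|u n| <= C * q ^+ n) -> (forall n, `|v n| <= C * q ^+ n) ->
  series u @ \oo --> l -> series v @ \oo --> l' ->
  series (cauchyprod u v) @ \oo --> l * l'.
Proof.
move=> C0 q0 q4 Hu Hv ul vl.
have q1 : q <= 1 by lra.
have c4 : geometric (C ^+ 2) (4 * q) @ \oo --> (0 : R).
  by apply: cvg_geometric; rewrite ger0_norm // mulr_ge0.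
suff D : (fun N => series u N * series v N - series (cauchyprod u v) N) @ \oo --> (0 : R).
  have <- : (fun N => series u N * series v N -
      (series u N * series v N - series (cauchyprod u v) N)) = series (cauchyprod u v).
    by apply/funext => N; rewrite /= opprB addrCA subrr addr0.
  by have := cvgB (cvgM ul vl) D; rewrite subr0; exact.
apply/norm_cvg0P; apply: squeeze_cvgr (cvg_cst 0) c4; near=> N.
rewrite normr_ge0 /= /series /= !big_mkord /cauchyprod (sum_triangle (fun i j => u i * v j)).
have -> : (\sum_(i < N) u i) * (\sum_(i < N) v i) -
    \sum_(i < N) \sum_(j < N - i) u i * v j =
  \sum_(i < N) \sum_(N - i <= j < N) u i * v j.
  rewrite mulr_suml -sumrB; apply: eq_bigr => i _.
  rewrite mulr_sumr -(big_mkord xpredT (fun j => u i * v j)).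
  rewrite (@big_cat_nat _ _ _ (N - i)) //= ?leq_subr //.
  by rewrite big_mkord [X in X - _]addrC addrK.
apply: (@le_trans _ _ (\sum_(i < N) \sum_(j < N) C ^+ 2 * q ^+ N)); last first.
  rewrite !sumr_const !card_ord -mulrnA -[leLHS]mulr_natl /geometric /=.
  rewrite [leLHS]mulrCA ler_wpM2l ?exprn_ge0 // exprMn.
  rewrite ler_wpM2r ?exprn_ge0 // natrM.
  have -> : 4 = 2 * 2 :> R by lra.
  have h : (N%:R : R) <= 2 ^+ N by rewrite -natrX ler_nat ltnW // ltn_expl.
  by rewrite exprMn ler_pM.
apply: (le_trans (ler_norm_sum _ _ _)); apply: ler_sum => i _.
apply: (le_trans (ler_norm_sum _ _ _)).
apply: (@le_trans _ _ (\sum_(N - i <= j < N) C ^+ 2 * q ^+ N)).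
  rewrite !big_nat; apply: ler_sum => j /andP[ij jN]; rewrite normrM.
  apply: (@le_trans _ _ ((C * q ^+ i) * (C * q ^+ j))); first exact: ler_pM.
  rewrite mulrACA -expr2 -exprD ler_wpM2l ?exprn_ge0 //.
  by apply: ler_wiXn2l => //; rewrite -leq_subLR.
rewrite -(big_mkord xpredT (fun=> C ^+ 2 * q ^+ N)).
rewrite [leRHS](@big_cat_nat _ _ _ (N - i)) //= ?leq_subr // lerDr.
by apply: sumr_ge0 => j _; rewrite mulr_ge0 ?exprn_ge0.
Unshelve. all: by end_near. Qed.

Lemma has_pseries_cauchyprod u v f g : has_pseries u f -> has_pseries v g ->
  has_pseries (cauchyprod u v) (fun s => f s * g s).
Proof.
move=> /near_right[e1 e10 He1] /near_right[e2 e20 He2].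
pose e := Num.min e1 e2 / 2; have e0 : 0 < e by rewrite divr_gt0 // lt_min e10.
have [ee1 ee2] : e < e1 /\ e < e2.
  have m1 : Num.min e1 e2 <= e1 by rewrite ge_min lexx.
  have m2 : Num.min e1 e2 <= e2 by rewrite ge_min lexx orbT.
  by split; rewrite /e in e0 *; lra.
have [C1 C10 H1] := pseries_growth e0 (He1 e ltac:(by rewrite e0)).
have [C2 C20 H2] := pseries_growth e0 (He2 e ltac:(by rewrite e0)).
(* The coefficients are O(e^-n), so s < e / 5 makes the ratio 4 s / e less
   than 1, as cvg_cauchyprod requires. *)
apply/near_right; exists (e / 5); first by rewrite divr_gt0.
move=> s /andP[s0 se].
have C0 : 0 <= C1 + C2 by rewrite addr_ge0.
have q0 : 0 <= s / e by rewrite divr_ge0 // ltW.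
have q4 : 4 * (s / e) < 1.
  by rewrite mulrA ltr_pdivrMr // mul1r; lra.
have c1 : pseries u s @ \oo --> f s by apply: He1; rewrite s0 /=; lra.
have c2 : pseries v s @ \oo --> g s by apply: He2; rewrite s0 /=; lra.
have bnd w (D : R) : (forall n, `|w n| <= D * e^-1 ^+ n) -> D <= C1 + C2 ->
    forall n, `|w n * s ^+ n| <= (C1 + C2) * (s / e) ^+ n.
  move=> Hw D1 n; rewrite normrM [`|s ^+ n|]ger0_norm ?exprn_ge0 ?(ltW s0) //.
  rewrite exprMn [s ^+ n * _]mulrC mulrA ler_wpM2r ?exprn_ge0 ?(ltW s0) //.
  apply: (le_trans (Hw n)); rewrite ler_wpM2r ?exprn_ge0 // invr_ge0 ltW //.
have := @cvg_cauchyprod _ _ _ _ _ _ C0 q0 q4 (bnd _ _ H1 _) (bnd _ _ H2 _) c1 c2.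
have -> : cauchyprod (fun n => u n * s ^+ n) (fun n => v n * s ^+ n) =
    (fun n => cauchyprod u v n * s ^+ n).
  apply/funext => m; rewrite /cauchyprod mulr_suml; apply: eq_bigr => i _.
  by rewrite mulrACA -exprD subnKC // leq_ord.
apply; [by rewrite lerDl | by rewrite lerDr].
Qed.

(** If m is the first index with w m <> 0, then w m s^m is at most a multiple of
s^(m+1) for small s. *)
Lemma has_pseries0_eq0 w : has_pseries w (fun=> 0) -> forall m, w m = 0.
Proof.
move=> /near_right[e e0 He] m.
have e20 : 0 < e / 2 by rewrite divr_gt0.
have [C C0 HC] := pseries_growth e20 (He (e / 2) ltac:(by rewrite e20 /=; lra)).
set r := (e / 2)^-1 in HC; have r0 : 0 < r by rewrite invr_gt0.
have [n mn] := ubnP m; elim: n m mn => // n IH m mn.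
apply/eqP; rewrite -normr_le0 leNgt; apply/negP => wm.
(* The terms after the m-th sum to at most 2 C (r s)^(m+1) when r s <= 1/2, so
   |w m| <= D s, which fails for s as chosen here. *)
pose D := 2 * C * r ^+ m.+1 + 1.
have D0 : 0 < D by rewrite ltr_wpDl // mulr_ge0 ?exprn_ge0 ?(ltW r0) // mulr_ge0.
pose s := Num.min (e / 4) (`|w m| / D / 2).
have s0 : 0 < s by rewrite lt_min !divr_gt0.
have se : s <= e / 4 by rewrite ge_min lexx.
have sw : s <= `|w m| / D / 2 by rewrite ge_min lexx orbT.
have rs0 : 0 <= r * s by rewrite mulr_ge0 // ltW.
have rs : r * s <= 2^-1.
  by rewrite /r mulrC ler_pdivrMr //; lra.
have geo N : (m < N)%N -> \sum_(m.+1 <= k < N) (r * s) ^+ k <=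
    2 * (r * s) ^+ m.+1 - 2 * (r * s) ^+ N.
  elim: N => // N IHN; rewrite ltnS leq_eqVlt => /orP[/eqP <-|mN].
    by rewrite big_geq // subrr.
  rewrite big_nat_recr //=; have := IHN mN.
  have : (r * s) ^+ N.+1 <= 2^-1 * (r * s) ^+ N.
    by rewrite exprS ler_wpM2r // exprn_ge0.
  by lra.
have key : `|w m| * s ^+ m <= 2 * C * (r * s) ^+ m.+1.
  have cs : pseries w s @ \oo --> (0 : R) by apply: He; rewrite s0 /=; lra.
  have cn : (fun N => `|pseries w s N - w m * s ^+ m|) @ \oo --> `|0 - w m * s ^+ m|.
    by apply: cvg_norm; apply: cvgB cs (cvg_cst _).
  rewrite sub0r normrN normrM [`|s ^+ m|]ger0_norm ?exprn_ge0 ?(ltW s0) // in cn.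
  apply: cvgr_to_le cn _; near=> N.
  have mN : (m < N)%N by near: N; exact: nbhs_infty_gt.
  rewrite /pseries /series /= (@big_cat_nat _ _ _ m.+1) //=.
  rewrite big_nat_recr //= big_nat big1 ?add0r; last first.
    by move=> i /andP[_ im]; rewrite IH ?mul0r // (leq_trans im).
  rewrite addrAC subrr add0r (le_trans (ler_norm_sum _ _ _)) //.
  apply: (@le_trans _ _ (C * \sum_(m.+1 <= k < N) (r * s) ^+ k)).
    rewrite mulr_sumr; apply: ler_sum => k _.
    rewrite normrM [`|s ^+ k|]ger0_norm ?exprn_ge0 ?(ltW s0) //.
    by rewrite exprMn mulrA ler_wpM2r ?exprn_ge0 ?(ltW s0).
  rewrite [2 * C]mulrC -mulrA ler_wpM2l //; apply: (le_trans (geo N mN)).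
  by rewrite lerBlDr lerDl mulr_ge0 // exprn_ge0.
have sm : 0 < s ^+ m by rewrite exprn_gt0.
move: key; rewrite exprMn [s ^+ m.+1]exprS !mulrA ler_pM2r //.
apply/negP; rewrite -ltNge.
apply: (@le_lt_trans _ _ (D * s)); first by rewrite ler_wpM2r ?(ltW s0) // /D lerDl.
apply: (@le_lt_trans _ _ (`|w m| / 2)); last by move: wm; lra.
by rewrite mulrC -ler_pdivlMr // mulrAC.
Unshelve. all: by end_near. Qed.

Lemma has_pseries_uniq u v f : has_pseries u f -> has_pseries v f -> u =1 v.
Proof.
move=> Hu Hv m; apply/eqP; rewrite -subr_eq0; apply/eqP; move: m.
apply: (@has_pseries0_eq0 (fun m => u m - v m)).
apply: filterS2 Hu Hv => s us vs.
have <- : (fun N => pseries u s N - pseries v s N) =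
    pseries (fun m => u m - v m) s.
  apply/funext => N; rewrite /pseries /series /= -sumrB; apply: eq_bigr => i _.
  by rewrite mulrBl.
by have := cvgB us vs; rewrite subrr; exact.
Qed.

Lemma has_pseries_scale u f c : 0 < c -> has_pseries u f ->
  has_pseries (fun n => c ^+ n * u n) (fun s => f (c * s)).
Proof.
move=> c0 /near_right[e e0 He]; apply/near_right; exists (e / c).
  by rewrite divr_gt0.
move=> s /andP[s0 se].
have -> : pseries (fun n => c ^+ n * u n) s = pseries u (c * s).
  apply/funext => N; rewrite /pseries /series /=; apply: eq_bigr => i _.
  by rewrite exprMn mulrAC mulrC.
by apply: He; rewrite mulr_gt0 //= mulrC -ltr_pdivlMr.
Qed.

End PowerSeries.

(** * Bernoulli numbers and the cotangent *)

Section Cotangent.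
Variable R : realType.
Implicit Types (c u v : nat -> R) (f g : R -> R) (s t : R).

Lemma has_pseries_ext u v f g : u =1 v -> (\forall s \near (0 : R)^'+, f s = g s) ->
  has_pseries u f -> has_pseries v g.
Proof.
by move=> /funext <- E H; rewrite /has_pseries; apply: filterS2 E H => s <-.
Qed.

(** Transfers a property of t and t^2 to sqrt s and s. *)
Lemma near_sqrt (P : R -> R -> Prop) e : 0 < e ->
  (forall t, 0 < t < e -> P t (t ^+ 2)) ->
  \forall s \near (0 : R)^'+, P (Num.sqrt s) s.
Proof.
move=> e0 H; apply/near_right; exists (e ^+ 2); first by rewrite exprn_gt0.
move=> s /andP[s0 se]; rewrite -{2}(sqr_sqrtr (ltW s0)); apply: H.
rewrite sqrtr_gt0 s0 /= -(ltr_pXn2r (ltn0Sn 1)) ?nnegrE ?sqrtr_ge0 ?ltW //.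
by rewrite sqr_sqrtr // ltW.
Qed.

Lemma pseries_even_odd c t (l1 l2 : R) : t != 0 ->
  pseries c t @ \oo --> l1 -> pseries c (- t) @ \oo --> l2 ->
  pseries (fun j => c j.*2) (t ^+ 2) @ \oo --> (l1 + l2) / 2 /\
  pseries (fun j => c j.*2.+1) (t ^+ 2) @ \oo --> (l1 - l2) / (2 * t).
Proof.
move=> t0 H1 H2.
have dbl (w : nat -> R) (l : R) : w @ \oo --> l -> (fun M => w M.*2) @ \oo --> l.
  move=> wl P /wl[n _ Hn]; exists n => // k /= nk; apply: Hn => /=.
  by rewrite (leq_trans nk) // -addnn leq_addr.
have S z M : pseries c z M.+1.*2 =
    pseries c z M.*2 + c M.*2 * z ^+ M.*2 + c M.*2.+1 * z ^+ M.*2.+1.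
  by rewrite /pseries /series /= doubleS !big_nat_recr.
have sq M z : z ^+ M.*2 = (z ^+ 2) ^+ M by rewrite -mul2n exprM.
have NE M : (- t) ^+ M.*2 = t ^+ M.*2 by rewrite !sq sqrrN.
have NO M : (- t) ^+ M.*2.+1 = - (t ^+ M.*2.+1) by rewrite !exprS NE mulNr.
split.
  have -> : pseries (fun j => c j.*2) (t ^+ 2) =
      (fun M => (pseries c t M.*2 + pseries c (- t) M.*2) / 2).
    apply/funext; elim=> [|M IH].
      by rewrite /pseries /series /= !big_geq // addr0 mul0r.
    rewrite {1}/pseries /series /= big_nat_recr //=.
    rewrite -[X in X + _]/(pseries (fun j => c j.*2) (t ^+ 2) M) IH !S NE NO -sq.
    by field.
  by apply: cvgM; [apply: cvgD; exact: dbl | exact: cvg_cst].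
have -> : pseries (fun j => c j.*2.+1) (t ^+ 2) =
      (fun M => (pseries c t M.*2 - pseries c (- t) M.*2) / (2 * t)).
  apply/funext; elim=> [|M IH].
    by rewrite /pseries /series /= !big_geq // subr0 mul0r.
  rewrite {1}/pseries /series /= big_nat_recr //=.
  rewrite -[X in X + _]/(pseries (fun j => c j.*2.+1) (t ^+ 2) M) IH !S NE NO -sq.
  by rewrite exprS; field.
by apply: cvgM; [apply: cvgB; exact: dbl | exact: cvg_cst].
Qed.

Lemma pseries_exp t : pseries (fun n => (n`!%:R)^-1) t @ \oo --> expR t.
Proof.
have -> : pseries (fun n => (n`!%:R)^-1) t = series (exp_coeff t).
  apply/funext => N; rewrite /pseries /series /=; apply: eq_bigr => i _.
  by rewrite /exp_coeff /= mulrC.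
exact: is_cvg_series_exp_coeff.
Qed.

Definition bern n : R := bernoulli R n / n`!%:R.

(** The coefficient of t^(2j) in t coth t = t (e^(2t) + 1) / (e^(2t) - 1). *)
Definition coth_coef j : R := 4 ^+ j * bern j.*2.

(** t coth t is the even part of u / (e^u - 1) at u = 2t. *)
Lemma has_pseries_coth : has_pseries coth_coef (fun s =>
  Num.sqrt s * (expR (2 * Num.sqrt s) + 1) / (expR (2 * Num.sqrt s) - 1)).
Proof.
have [e /= e0 He] := bernoulliP R.
have e20 : 0 < e / 2 by rewrite divr_gt0.
apply: (near_sqrt (P := fun t s => pseries coth_coef s @ \oo -->
  t * (expR (2 * t) + 1) / (expR (2 * t) - 1)) e20) => t /andP[t0 te].
have tt0 : 2 * t != 0 by rewrite mulf_neq0 ?gt_eqF.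
have te' : `|2 * t| < e by rewrite gtr0_norm; lra.
have H1 : pseries bern (2 * t) @ \oo --> 2 * t / (expR (2 * t) - 1).
  apply: He => //. rewrite /ball_ /= sub0r normrN; exact: te'.
have H2 : pseries bern (- (2 * t)) @ \oo --> - (2 * t) / (expR (- (2 * t)) - 1).
  apply: He; rewrite ?oppr_eq0 // /ball_ /= sub0r opprK; exact: te'.
have [H _] := pseries_even_odd tt0 H1 H2.
have E0 : expR (2 * t) - 1 != 0.
  rewrite subr_eq0; apply: contra_neq tt0 => h.
  by apply: expR_inj; rewrite h expR0.
have -> : pseries coth_coef (t ^+ 2) = pseries (fun j => bern j.*2) ((2 * t) ^+ 2).
  apply/funext => N; rewrite /pseries /series /=; apply: eq_bigr => i _.
  have -> : (2 * t) ^+ 2 = 4 * t ^+ 2 by ring.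
  by rewrite /coth_coef [(4 * _) ^+ i]exprMn [RHS]mulrA [bern _ * _]mulrC.
have -> : t * (expR (2 * t) + 1) / (expR (2 * t) - 1) = (2 * t / (expR (2 * t) - 1) +
   - (2 * t) / (expR (- (2 * t)) - 1)) / 2.
  have E1 := lt0r_neq0 (expR_gt0 (2 * t)).
  rewrite expRN; move: (expR (2 * t)) E0 E1 => E E0 E1.
  have E2 : 1 - E != 0 by rewrite -opprB oppr_eq0.
  have -> : E^-1 - 1 = (1 - E) / E by field.
  by field; rewrite E0 E1 E2.
exact: H.
Qed.

Definition cosh_coef j : R := (j.*2`!%:R)^-1.
Definition sinh_coef j : R := (j.*2.+1`!%:R)^-1.

(** t coth t times sinh t / t is cosh t.  Being an identity between coefficients,
it survives the change of signs that leads to the circular functions. *)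
Lemma cauchyprod_coth_sinh : cauchyprod coth_coef sinh_coef =1 cosh_coef.
Proof.
pose ch s : R := (expR (Num.sqrt s) + expR (- Num.sqrt s)) / 2.
pose sh s : R := (expR (Num.sqrt s) - expR (- Num.sqrt s)) / (2 * Num.sqrt s).
have Hch : has_pseries cosh_coef ch.
  apply: (near_sqrt (P := fun t s => pseries cosh_coef s @ \oo -->
    (expR t + expR (- t)) / 2) ltr01) => t /andP[t0 _].
  by have [H _] := pseries_even_odd (lt0r_neq0 t0) (@pseries_exp t) (@pseries_exp (- t)).
have Hsh : has_pseries sinh_coef sh.
  apply: (near_sqrt (P := fun t s => pseries sinh_coef s @ \oo -->
    (expR t - expR (- t)) / (2 * t)) ltr01) => t /andP[t0 _].
  by have [_ H] := pseries_even_odd (lt0r_neq0 t0) (@pseries_exp t) (@pseries_exp (- t)).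
apply: has_pseries_uniq Hch.
apply: has_pseries_ext (has_pseries_cauchyprod has_pseries_coth Hsh) => //.
apply: (near_sqrt (P := fun t s => t * (expR (2 * t) + 1) / (expR (2 * t) - 1) *
  ((expR t - expR (- t)) / (2 * t)) = (expR t + expR (- t)) / 2) ltr01).
move=> t /andP[t0 _]; have t0' := lt0r_neq0 t0.
have tt0 : 2 * t != 0 by rewrite mulf_neq0 ?gt_eqF.
have E0 : expR (2 * t) - 1 != 0.
  rewrite subr_eq0; apply: contra_neq tt0 => h.
  by apply: expR_inj; rewrite h expR0.
have E1 := lt0r_neq0 (expR_gt0 t).
have E2 : expR (2 * t) = expR t ^+ 2 by rewrite expr2 -expRD; congr expR; ring.
rewrite E2 in E0 *; rewrite expRN; move: (expR t) E0 E1 => E E0 E1.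
by field; rewrite E1 t0' E0.
Qed.

Definition sgn_coef u j : R := (-1) ^+ j * u j.

Lemma cauchyprod_sgn u v : cauchyprod (sgn_coef u) (sgn_coef v) =1 sgn_coef (cauchyprod u v).
Proof.
move=> m; rewrite /cauchyprod /sgn_coef mulr_sumr; apply: eq_bigr => i _.
by rewrite mulrACA -exprD subnKC // leq_ord.
Qed.

Lemma has_pseries_cos : has_pseries (sgn_coef cosh_coef) (fun s => cos (Num.sqrt s)).
Proof.
apply: (near_sqrt (P := fun t s => pseries (sgn_coef cosh_coef) s @ \oo --> cos t)
  ltr01) => t _.
have -> : pseries (sgn_coef cosh_coef) (t ^+ 2) = series (cos_coeff' t).
  apply/funext => N; rewrite /pseries /series /=; apply: eq_bigr => i _.
  by rewrite /sgn_coef /cosh_coef /cos_coeff' -exprM mul2n mulrAC.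
exact: cvg_cos_coeff'.
Qed.

Lemma has_pseries_sin : has_pseries (sgn_coef sinh_coef)
  (fun s => sin (Num.sqrt s) / Num.sqrt s).
Proof.
apply: (near_sqrt (P := fun t s => pseries (sgn_coef sinh_coef) s @ \oo --> sin t / t)
  ltr01) => t /andP[t0 _].
have -> : pseries (sgn_coef sinh_coef) (t ^+ 2) = (fun N => series (sin_coeff' t) N / t).
  apply/funext => N; rewrite /pseries /series /= mulr_suml; apply: eq_bigr => i _.
  rewrite /sgn_coef /sinh_coef /sin_coeff' -exprM mul2n exprS.
  by rewrite -[LHS](mulfK (lt0r_neq0 t0)); congr (_ / _); rewrite /exprz /=; ring.
by apply: cvgM; [exact: cvg_sin_coeff' | exact: cvg_cst].
Qed.

Definition cot_coef := sgn_coef coth_coef.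

(** The series converges where that of t coth t does, and its product with
sin t / t is cos t. *)
Lemma has_pseries_cot : has_pseries cot_coef (fun s => xcot (Num.sqrt s)).
Proof.
pose L s := limn (pseries cot_coef s).
have HL : has_pseries cot_coef L.
  have /near_right[e e0 He] := has_pseries_coth.
  apply/near_right; exists (e / 2); first by rewrite divr_gt0.
  move=> s /andP[s0 se].
  have e20 : 0 < e / 2 < e by apply/andP; split; lra.
  have Ns : `|- s| < `|e / 2| by rewrite normrN !gtr0_norm //; lra.
  rewrite /L; have -> : pseries cot_coef s = pseries coth_coef (- s).
    apply/funext => N; rewrite /pseries /series /=; apply: eq_bigr => i _.
    by rewrite /cot_coef /sgn_coef [in RHS]exprNn; ring.
  have Hc := cvgP _ (He _ e20).
  exact: (is_cvg_pseries_inside Hc Ns).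
have H := has_pseries_cauchyprod HL has_pseries_sin.
have p2 := pi_ge2 R.
have pos : \forall s \near (0 : R)^'+, 0 < sin (Num.sqrt s) /\ 0 < Num.sqrt s.
  apply: (near_sqrt (P := fun t s => 0 < sin t /\ 0 < t) ltr01) => t /andP[t0 t1].
  by split=> //; apply: sin_gt0_pihalf; apply/andP; split; lra.
apply: has_pseries_ext HL => //.
have Hc := has_pseries_cos.
apply: filterS3 H Hc pos => s h1 h2 [p q].
have E : cauchyprod cot_coef (sgn_coef sinh_coef) = sgn_coef cosh_coef.
  by apply/funext => m; rewrite cauchyprod_sgn /sgn_coef cauchyprod_coth_sinh.
rewrite E in h1; have := cvg_unique _ h1 h2 => /(_ (@norm_hausdorff _ _)).
rewrite /xcot => <-.
by field; rewrite !lt0r_neq0.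
Qed.

Definition tan_coef k : R := (1 - 4 ^+ k.+1) * cot_coef k.+1.

(** tan t = cot t - 2 cot 2t. *)
Lemma has_pseries_tan : has_pseries tan_coef (fun s => (xcot (Num.sqrt s))^-1).
Proof.
have h4 : (0 : R) < 4 by [].
have H1 := has_pseries_cot; have H4 := has_pseries_scale h4 has_pseries_cot.
have p2 := pi_ge2 R.
have pos : \forall s \near (0 : R)^'+,
   [/\ 0 < s, Num.sqrt (4 * s) = 2 * Num.sqrt s &
   (xcot (Num.sqrt s) - xcot (2 * Num.sqrt s)) / s = (xcot (Num.sqrt s))^-1].
  apply: (near_sqrt (P := fun t s => [/\ 0 < s, Num.sqrt (4 * s) = 2 * t &
    (xcot t - xcot (2 * t)) / s = (xcot t)^-1]) (e := 2^-1)) => // t /andP[t0 t1].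
  have s0 : 0 < sin t by apply: sin_gt0_pihalf; apply/andP; split; lra.
  have c0 : 0 < cos t by apply: cos_gt0_pihalf; apply/andP; split; lra.
  split; first by rewrite exprn_gt0.
    rewrite (_ : 4 * t ^+ 2 = (2 * t) ^+ 2); last by ring.
    by rewrite sqrtr_sqr gtr0_norm // mulr_gt0.
  rewrite /xcot (_ : sin (2 * t) = 2 * sin t * cos t); last first.
    by rewrite mulr_natl sin_mulr2n -mulr_natl; ring.
  rewrite (_ : cos (2 * t) = 1 - 2 * sin t ^+ 2); last first.
    by rewrite mulr_natl cos_mulr2n cos2sin2; ring.
  have C := sin2cos2 t.
  have s0' := lt0r_neq0 s0; have c0' := lt0r_neq0 c0; have t0' := lt0r_neq0 t0.
  transitivity ((cos t ^+ 2 - 1 + 2 * sin t ^+ 2) / (t * sin t * cos t)).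
    by field; rewrite s0' c0' t0'.
  have -> : cos t ^+ 2 - 1 + 2 * sin t ^+ 2 = sin t ^+ 2 by rewrite C; ring.
  by field; rewrite s0' c0' t0'.
have /near_right[e e0 He] : \forall s \near (0 : R)^'+,
    pseries tan_coef s @ \oo --> (xcot (Num.sqrt s))^-1; last first.
  by apply/near_right; exists e.
apply: filterS3 H1 H4 pos => s h1 h4' [s0 sq <-].
rewrite sq in h4'.
have -> : pseries tan_coef s = (fun N =>
   (pseries cot_coef s N.+1 - pseries (fun n => 4 ^+ n * cot_coef n) s N.+1) / s).
  apply/funext => N; rewrite /pseries /series /= -sumrB mulr_suml.
  rewrite big_nat_recl //= expr0 !mul1r subrr mul0r add0r; apply: eq_bigr => i _.
  by rewrite /tan_coef [s ^+ i.+1]exprS; field; exact: lt0r_neq0.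
apply: cvgM; last exact: cvg_cst.
by apply: cvgB; rewrite cvg_shiftS.
Qed.
End Cotangent.

(** * Comparison of coefficients *)

Section Coefficients.
Variable R : realType.

Lemma cvg_star_lim j n : starsums R (half31 j) n @ \oo --> star_lim R j n.
Proof.
(* The coefficients do not depend on x and y: one admissible point suffices. *)
have Ha : 0 < (8^-1 : R) <= 4^-1 by apply/andP; split; lra.
have Hb : 0 < (4^-1 : R) <= 4^-1 by apply/andP; split; lra.
pose x : R := 5 / 128; pose y : R := 3 / 128.
have Ea : x - y = 8^-1 ^+ 2 by rewrite /x /y; field.
have Eb : x + y = 4^-1 ^+ 2 by rewrite /x /y; field.
have y0 : 0 < y by rewrite /y; lra.
exact: (cvg_homog_xcot Ha Hb Ea Eb y0).1.
Qed.

Lemma sum_zeta_star j n : (\sum_(c <- half31 j n) zeta_star R c = (star_lim R j n)%:E)%E.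
Proof.
have H1 : (fun K => \sum_(c <- half31 j n) (starsum R c K)%:E)%E @ \oo -->
    (\sum_(c <- half31 j n) zeta_star R c)%E.
  apply: cvg_nnesum => c _; last exact: zeta_star_cvg.
  by near=> K; rewrite lee_fin starsum_ge0.
have H2 : (fun K => \sum_(c <- half31 j n) (starsum R c K)%:E)%E @ \oo -->
    (star_lim R j n)%:E.
  under eq_fun do rewrite sumEFin.
  by apply: cvg_EFin; [near=> K | exact: cvg_star_lim].
exact: cvg_unique H1 H2.
Unshelve. all: by end_near. Qed.

Lemma homog_scale (s xi : R) f m : homog (s * xi) s f m = homog xi 1 f m * s ^+ m.
Proof.
rewrite /homog mulr_suml; apply: eq_bigr => j _.
have -> : s ^+ m = s ^+ j * s ^+ (m - j) by rewrite -exprD subnKC // leq_ord.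
by rewrite exprMn expr1n mul1r; move: (s ^+ j) (s ^+ _) (xi ^+ _) => a b c; ring.
Qed.

Let cA (xi : R) : R := pi ^+ 2 / 4 * (xi - 1).
Let cB (xi : R) : R := pi ^+ 2 / 4 * (xi + 1).

(** Uniqueness of the coefficients in s, at y = s and x = s xi; the condition on xi
keeps x - y positive, so that it has a positive square root. *)
Lemma homog_star_lim_cauchy (xi : R) m : 2 <= xi <= 3 -> homog xi 1 (star_lim R) m =
  cauchyprod (fun n => cB xi ^+ n * tan_coef R n)
             (fun n => cA xi ^+ n * cot_coef R n) m.
Proof.
move=> /andP[xi2 xi3]; have p0 : (0 : R) < pi := pi_gt0 R.
have cA0 : 0 < cA xi by rewrite mulr_gt0 ?divr_gt0 ?exprn_gt0 //; lra.
have cB0 : 0 < cB xi by rewrite mulr_gt0 ?divr_gt0 ?exprn_gt0 //; lra.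
have Hr := has_pseries_cauchyprod (has_pseries_scale cB0 (has_pseries_tan R))
                            (has_pseries_scale cA0 (has_pseries_cot R)).
apply: (has_pseries_uniq (u := homog xi 1 (star_lim R)) _ Hr m).
(* As xi + 1 <= 4, this bound gives a, b <= 1/4 below. *)
apply/near_right; exists 64^-1; first by rewrite invr_gt0.
move=> s /andP[s0 s1].
pose a := Num.sqrt (s * (xi - 1)); pose b := Num.sqrt (s * (xi + 1)).
have a20 : 0 < s * (xi - 1) by rewrite mulr_gt0 //; lra.
have b20 : 0 < s * (xi + 1) by rewrite mulr_gt0 //; lra.
have Ea : s * xi - s = a ^+ 2 by rewrite sqr_sqrtr ?ltW //; ring.
have Eb : s * xi + s = b ^+ 2 by rewrite sqr_sqrtr ?ltW //; ring.
have sqle (z : R) : 0 < z -> z <= 4^-1 ^+ 2 -> 0 < Num.sqrt z <= (4^-1 : R).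
  move=> z0 z1; rewrite sqrtr_gt0 z0 /= -(ler_pXn2r (ltn0Sn 1)) ?nnegrE ?sqrtr_ge0 //.
  by rewrite sqr_sqrtr // ltW.
have s64 : s * 4 <= 4^-1 ^+ 2 by rewrite expr2; lra.
have Ha : 0 < a <= 4^-1.
  apply: sqle => //; apply: le_trans s64; rewrite ler_wpM2l ?ltW //; lra.
have Hb : 0 < b <= 4^-1.
  apply: sqle => //; apply: le_trans s64; rewrite ler_wpM2l ?(ltW s0) //; lra.
have [_ H] := cvg_homog_xcot Ha Hb Ea Eb s0.
have sq (c z : R) : 0 < z -> Num.sqrt (pi ^+ 2 / 4 * c * z) = pi * Num.sqrt (z * c) / 2.
  move=> z0; have -> : pi ^+ 2 / 4 * c * z = (pi / 2) ^+ 2 * (z * c).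
    by move: (pi : R) => p; field.
  have h : 0 <= pi / 2 :> R by rewrite divr_ge0 // ltW.
  rewrite sqrtrM; last exact: sqr_ge0.
  by rewrite sqrtr_sqr ger0_norm // mulrAC.
rewrite /= /cA /cB !sq // -/a -/b mulrC.
have <- : (fun M => \sum_(m < M) homog (s * xi) s (star_lim R) m) =
    pseries (homog xi 1 (star_lim R)) s; last exact: H.
  apply/funext => M; rewrite /pseries /series /= big_mkord.
  by apply: eq_bigr => i _; exact: homog_scale.
Qed.

Lemma coef_XaddC_exp (c : R) q p : c ^+ 2 = 1 ->
  (('X + c%:P) ^+ q)`_p = 'C(q, p)%:R * c ^+ (q + p).
Proof.
move=> c2; elim: q p => [|q IH] p.
  by rewrite expr0 coef1 bin0n; case: p => [|p]; rewrite ?expr0 ?mulr1 ?mul0r.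
rewrite exprS mulrDl coefD coefXM coefCM !IH; case: p => [|p].
  by rewrite !bin0 !addn0 add0r !mul1r exprS.
have E1 : c ^+ (q.+1 + p.+1) = c ^+ (q + p).
  by rewrite addSn addnS !exprS mulrA -expr2 c2 mul1r.
have E2 : c * c ^+ (q + p.+1) = c ^+ (q + p).
  by rewrite addnS exprS mulrA -expr2 c2 mul1r.
by rewrite /= binS natrD E1 mulrCA E2; ring.
Qed.

Lemma poly_eq_on_segment (p q : {poly R}) :
  (forall x, 2 <= x <= 3 -> p.[x] = q.[x]) -> p = q.
Proof.
move=> H; apply/eqP; rewrite -subr_eq0; apply/eqP.
pose N := size (p - q).
pose rs : seq R := [seq 2 + i%:R / N.+1%:R | i <- iota 0 N].
have N0 : 0 < N.+1%:R :> R by [].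
apply: (@roots_geq_poly_eq0 _ _ rs); last by rewrite size_map size_iota.
  apply/allP => x /mapP[i]; rewrite mem_iota => /= iN ->.
  rewrite /root hornerD hornerN H ?subrr // lerDl divr_ge0 //=.
  have : i%:R / N.+1%:R <= 1 :> R.
    by rewrite ler_pdivrMr // mul1r ler_nat ltnW // ltnW.
  by move: (_ / _) => z; lra.
rewrite map_inj_uniq ?iota_uniq // => i j /addrI /(mulIf _).
by rewrite invr_eq0 gt_eqF // => /(_ isT) /eqP; rewrite eqr_nat => /eqP.
Qed.

(** Coefficient of xi^n in the identity between polynomials of homog_star_lim_cauchy,
where the right-hand side is a combination of (xi+1)^k (xi-1)^(m-k). *)
Lemma star_limE j n : star_lim R j n = 4 * pi ^+ (2 * (j + n)) *
  \sum_(0 <= k < (j + n).+1) \sum_(0 <= r < n.+1)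
    (-1) ^+ (n + k + r) * (4 ^+ k.+1 - 1) *
    'C(k, r)%:R * 'C(j + n - k, n - r)%:R *
    (bernoulli R (2 * k + 2) / (2 * k + 2)`!%:R) *
    (bernoulli R (2 * (j + n) - 2 * k) / (2 * (j + n) - 2 * k)`!%:R).
Proof.
set m := (j + n)%N; have p0 : (pi : R) != 0 by rewrite gt_eqF // pi_gt0.
pose pL : {poly R} := \poly_(i < m.+1) star_lim R (m - i) i.
pose e k : R := (pi ^+ 2 / 4) ^+ m * (tan_coef R k * cot_coef R (m - k)).
pose pR : {poly R} := \sum_(k < m.+1)
  e k *: (('X + 1%:P) ^+ k * ('X + (-1)%:P) ^+ (m - k)).
have pLR : pL = pR.
  apply: poly_eq_on_segment => x x23.
  have := homog_star_lim_cauchy m x23.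
  have -> : homog x 1 (star_lim R) m = pL.[x].
    rewrite horner_poly /homog (reindex_inj rev_ord_inj) /=.
    apply: eq_bigr => i _; rewrite subSS subKn ?leq_ord // expr1n mul1r.
    by rewrite mulrC.
  move=> ->; rewrite horner_sum /cauchyprod; apply: eq_bigr => k _.
  rewrite hornerZ hornerM !horner_exp !hornerD !hornerX !hornerC /e /cA /cB.
  move: (pi ^+ 2 / 4 : R) => g.
  have -> : g ^+ m = g ^+ k * g ^+ (m - k) by rewrite -exprD subnKC // leq_ord.
  by rewrite !exprMn; move: (g ^+ k) (g ^+ (m - k)) => a b; ring.
have -> : star_lim R j n = pL`_n.
  by rewrite coef_poly ltnS leq_addl /m addnK.
rewrite pLR coef_sum big_mkord mulr_sumr; apply: eq_bigr => k _.
have km : (k <= m)%N by rewrite leq_ord.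
rewrite coefZ coefM mulr_sumr big_mkord mulr_sumr; apply: eq_bigr => r _.
have rn : (r <= n)%N by rewrite leq_ord.
rewrite !coef_XaddC_exp ?expr1n ?sqrrN ?expr1n // mulr1.
rewrite /e /tan_coef /cot_coef /sgn_coef /coth_coef /bern.
have -> : (2 * k + 2 = k.+1.*2)%N by lia.
have -> : (2 * m - 2 * k = (m - k).*2)%N by lia.
set b1 : R := bernoulli R _ / _; set b2 : R := bernoulli R _ / _.
have E4 : (pi ^+ 2 / 4) ^+ m * (4 ^+ k.+1 * 4 ^+ (m - k)) = 4 * pi ^+ (2 * m) :> R.
  have -> : 4 ^+ k.+1 * 4 ^+ (m - k) = 4 * 4 ^+ m :> R.
    by rewrite exprS -mulrA -exprD subnKC.
  by rewrite exprM expr_div_n mulrCA divfK // expf_neq0.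
have Es : (-1) ^+ (n + k + r) = - ((-1) ^+ k.+1 * (-1) ^+ (m - k) *
    (-1) ^+ (m - k + (n - r))) :> R.
  rewrite -!exprD -[RHS]mulN1r -exprS -[LHS]signr_odd -[RHS]signr_odd.
  by congr (_ ^+ nat_of_bool _); lia.
rewrite Es -E4.
move: ((-1) ^+ k.+1) ((-1) ^+ (m - k)) ((-1) ^+ (m - k + (n - r))) => s1 s2 s3.
move: (4 ^+ k.+1) (4 ^+ (m - k)) ((_ / _) ^+ m) => f1 f2 f3; ring.
Qed.

End Coefficients.

Lemma Zstar0_star_lim (R : realType) d n : Zstar0 R d n = (star_lim R d.*2 n)%:E.
Proof. by rewrite Zstar0E sum_zeta_star. Qed.

Lemma Zstar1_star_lim (R : realType) d n : Zstar1 R d n.+1 = (star_lim R d.*2.+1 n)%:E.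
Proof. by rewrite Zstar1E sum_zeta_star. Qed.

Lemma Zstar_star_lim0 (R : realType) d : Zstar R d 0 = (star_lim R d.*2 0)%:E.
Proof. by rewrite ZstarE (full31_split _ _).1 sum_zeta_star. Qed.

Lemma Zstar_star_limS (R : realType) d n :
  Zstar R d n.+1 = (star_lim R d.*2 n.+1 + star_lim R d.*2.+1 n)%:E.
Proof. by rewrite ZstarE (full31_split _ _).2 !sum_zeta_star. Qed.

Theorem theorem1p2 (R : realType) (d n : nat) (hd : (0 < d)%N) :
  [/\ Zstar0 R d n =
        (4 * pi ^+ (2 * n + 4 * d) *
         \sum_(0 <= k < (n + 2 * d).+1) \sum_(0 <= r < n.+1)
           (-1) ^+ (n + k + r) * (4 ^+ k.+1 - 1) *
           'C(k, r)%:R * 'C(n + 2 * d - k, n - r)%:R *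
           (bernoulli R (2 * k + 2) / (2 * k + 2)`!%:R) *
           (bernoulli R (2 * n + 4 * d - 2 * k) /
              (2 * n + 4 * d - 2 * k)`!%:R))%:E,
      Zstar R d n =
        (4 * pi ^+ (2 * n + 4 * d) *
         \sum_(0 <= k < (n + 2 * d).+1) \sum_(0 <= r < n.+1)
           (-1) ^+ (n + k + r) * (4 ^+ k.+1 - 1) *
           'C(k.+1, r)%:R * 'C(n + 2 * d - k, n - r)%:R *
           (bernoulli R (2 * k + 2) / (2 * k + 2)`!%:R) *
           (bernoulli R (2 * n + 4 * d - 2 * k) /
              (2 * n + 4 * d - 2 * k)`!%:R))%:E
    & (1 <= n)%N ->
      Zstar1 R d n =
        (4 * pi ^+ (2 * n + 4 * d) *
         \sum_(0 <= k < (n + 2 * d).+1) \sum_(0 <= r < n)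
           (-1) ^+ (n + k + r + 1) * (4 ^+ k.+1 - 1) *
           'C(k, r)%:R * 'C(n + 2 * d - k, n - 1 - r)%:R *
           (bernoulli R (2 * k + 2) / (2 * k + 2)`!%:R) *
           (bernoulli R (2 * n + 4 * d - 2 * k) /
              (2 * n + 4 * d - 2 * k)`!%:R))%:E].
Proof.
pose b s := bernoulli R s / s`!%:R.
pose t n k r c1 c2 : R := (-1) ^+ (n + k + r) * (4 ^+ k.+1 - 1) * c1%:R * c2%:R *
  b (2 * k + 2)%N * b (2 * n + 4 * d - 2 * k)%N.
(* star_limE at j = 2d and j = 2d+1; in the second case the sign refers to N+1,
   the number of twos including the one that the last block must contain. *)
have E0 N : star_lim R d.*2 N = 4 * pi ^+ (2 * N + 4 * d) *
    \sum_(0 <= k < (N + 2 * d).+1) \sum_(0 <= r < N.+1)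
      t N k r 'C(k, r) 'C(N + 2 * d - k, N - r).
  rewrite star_limE.
  have -> : (d.*2 + N = N + 2 * d)%N by lia.
  by have -> : (2 * (N + 2 * d) = 2 * N + 4 * d)%N by lia.
have E1 N : star_lim R d.*2.+1 N = 4 * pi ^+ (2 * N.+1 + 4 * d) *
    \sum_(0 <= k < (N.+1 + 2 * d).+1) \sum_(0 <= r < N.+1)
      - t N.+1 k r 'C(k, r) 'C(N.+1 + 2 * d - k, N - r).
  rewrite star_limE.
  have -> : (d.*2.+1 + N = N.+1 + 2 * d)%N by lia.
  have -> : (2 * (N.+1 + 2 * d) = 2 * N.+1 + 4 * d)%N by lia.
  congr (_ * _); apply: eq_bigr => k _; apply: eq_bigr => r _.
  have E : (-1) ^+ (N.+1 + k + r) = - (-1) ^+ (N + k + r) :> R.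
    by rewrite !addSn exprS mulN1r.
  by rewrite /t E !mulNr opprK.
have En : forall N, (-1 : R) ^+ (N + 1) = - (-1) ^+ N.
  by move=> N; rewrite addn1 exprS mulN1r.
split.
- by rewrite Zstar0_star_lim E0.
- case: n => [|n].
    rewrite Zstar_star_lim0 E0; congr (_ * _)%:E; apply: eq_bigr => k _.
    by rewrite !big_nat1 !bin0.
  rewrite Zstar_star_limS E0 E1 -mulrDr; congr (_ * _)%:E.
  rewrite -big_split /=; apply: eq_bigr => k _.
  (* Pascal's rule, after separating the term r = 0. *)
  rewrite big_nat_recl // [in RHS]big_nat_recl // -addrA !bin0; congr (_ + _).
  rewrite -big_split /=; apply: eq_bigr => r _.
  rewrite subSS binS /t natrD addnS [(-1) ^+ _.+1]exprS -!/(b _).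
  by move: (b _) (b _) => b1 b2; ring.
- case: n => // n _; rewrite Zstar1_star_lim E1; congr (_ * _)%:E.
  apply: eq_bigr => k _; apply: eq_bigr => r _.
  by rewrite En /t -!mulNr subSS subn0.
Qed.
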